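(* There exists an EAKF update map $\Gamma$ (in the sense defined in the context) such that the following holds for the signal-ensemble process $X_n=(U_n,V_n^{(1)},\dots,V_n^{(K)})$ generated with $\Gamma$. Assume: (a) (Kinetic energy principle) there exist $\beta_h\in(0,1)$, $K_h>0$ with $|\Psi_h(u)|^2+\mathrm{tr}(R_h(u))\le(1-\beta_h)|u|^2+K_h$ for all $u\in\mathbb{R}^d$. (b) (Nondegenerate system noise) for any $M_1,M_2>0$ there is $\alpha>0$ such that $\mathbb{P}(\zeta_n\in\cdot\mid U_{n-1}=u)\ge\alpha\,\lambda_{M_2}(\cdot)$ for all $|u|\le M_1$, where $\lambda_{M_2}$ is Lebesgue measure on $\mathbb{R}^d$ restricted to $\{x:|x|\le M_2\}$. (c) (Strong Lyapunov function) there are a function $\mathcal{E}:\mathbb{R}^d\times\mathbb{R}^{d\times K}\to[0,\infty)$ with compact sub-level sets and constants $\beta\in(0,1)$, $c>0$ such that $\mathbb{E}_{n-1}\mathcal{E}(X_n)\le(1-\beta)\mathcal{E}(X_{n-1})+c$ for all $n\ge1$ (for every initial condition). Then $X_n$ is geometrically ergodic in total variation distance.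
   Context: Signal and observations. Fix $h>0$, integers $1\le q\le d$, $K\ge2$, and $H\in\mathbb{R}^{q\times d}$ of rank $q$. $\Psi_h:\mathbb{R}^d\to\mathbb{R}^d$ is a measurable map. The signal in $\mathbb{R}^d$ and observation in $\mathbb{R}^q$ are $$U_n=\Psi_h(U_{n-1})+\zeta_n,\qquad Z_n=HU_n+\xi_n .$$ Given the past up to time $n-1$, the law of $\zeta_n$ depends only on $U_{n-1}$ (through a time-independent kernel); given $U_{n-1}=u$ it has mean $0$ and covariance matrix $R_h(u)$. The $\xi_n$ are i.i.d. with mean $0$ and covariance $I_q$, independent of everything else. EAKF update maps. An EAKF update map is a (measurable) map $$\Gamma:\mathbb{R}^d\times\mathbb{R}^{d\times K}\times\mathbb{R}^q\to\mathbb{R}^d\times\mathbb{R}^{d\times K},\qquad \Gamma(U,\widehat V^{(1)},\dots,\widehat V^{(K)},Z)=(U,\Gamma^{(1)},\dots,\Gamma^{(K)}),$$ $$\Gamma^{(k)}=\overline{\widehat V}-\widehat CH^T(I+H\widehat CH^T)^{-1}(H\overline{\widehat V}-Z)+S^{(k)},$$ where $\overline{\widehat V}=\frac1K\sum_k\widehat V^{(k)}$, $\widehat S=[\widehat V^{(1)}-\overline{\widehat V},\dots,\widehat V^{(K)}-\overline{\widehat V}]\in\mathbb{R}^{d\times K}$, $\widehat C=\frac1{K-1}\widehat S\widehat S^T$, and $S^{(k)}$ is the $k$-th column of a matrix $S$ obtained from some choice of the following decompositions: 1. a (reduced) singular value decomposition $\widehat S=Q_1\Lambda_1R_1$, where,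 with $p=\mathrm{rank}(\widehat S)$, $Q_1\in\mathbb{R}^{d\times p}$ has orthonormal columns, $R_1\in\mathbb{R}^{p\times K}$ has orthonormal rows, and $\Lambda_1$ is a $p\times p$ diagonal matrix with positive, descending diagonal entries; 2. an eigenvalue decomposition $G_1^TD_1G_1=(K-1)^{-1}\Lambda_1Q_1^TH^THQ_1\Lambda_1$ with $G_1\in\mathbb{R}^{p\times p}$ orthogonal and $D_1$ diagonal with nonnegative descending diagonal entries; 3. $S=Q_1\Lambda_1G_1^T(I+D_1)^{-1/2}R_1$ (equivalently $S=A\widehat S$ with $A=Q_1\Lambda_1G_1^T(I+D_1)^{-1/2}\Lambda_1^{-1}Q_1^T$; $S=0$ if $\widehat S=0$). Since the decompositions are not unique, there are many EAKF update maps; each arises from a fixed choice of decompositions for every input. Filter process generated by $\Gamma$. Given $(U_{n-1},V_{n-1}^{(1)},\dots,V_{n-1}^{(K)})$, set $\widehat V_n^{(k)}=\Psi_h(V_{n-1}^{(k)})+\zeta_n^{(k)}$, where $\zeta_n^{(k)}$ has the conditional law that $\zeta_n$ has given $U_{n-1}=V_{n-1}^{(k)}$; given the past up to time $n-1$, the noises $\zeta_n,\zeta_n^{(1)},\dots,\zeta_n^{(K)},\xi_n$ are independent. Then $X_n=(U_n,V_n^{(1)},\dots,V_n^{(K)})=\Gamma(U_n,\widehat V_n^{(1)},\dots,\widehat V_n^{(K)},Z_n)$. $X_n$ is a Markov chain; $\mathcal{F}_n=\sigma\{X_m:m\le n\}$ and $\mathbb{E}_n$ is conditional expectation given $\mathcal{F}_n$.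 Geometric ergodicity (in total variation) of $X_n$ means: there is a unique invariant probability measure $\pi$ and constants $r\in(0,1)$, $\kappa>0$ such that for every initial probability distribution $\mu$ and all $n\ge0$, $\|\mathbb{P}^\mu(X_n\in\cdot)-\pi\|_{TV}\le\kappa r^n\big(1+\int\mathcal{E}\,d\mu\big)$. In particular, for initial laws $\mu,\nu$ integrating $\mathcal{E}$ and $P$ the transition kernel, $\|P^n\mu-P^n\nu\|_{TV}\le C_{\mu,\nu}r^n$. *)

(* Defs.v *)
From HB Require Import structures.
From mathcomp Require Import all_boot all_order all_algebra.
From mathcomp Require Import all_classical all_reals all_analysis.
From mathcomp Require Import measurable_realfun.

Set Implicit Arguments.
Unset Strict Implicit.
Unset Printing Implicit Defensive.

Import Order.TTheory GRing.Theory Num.Theory.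
Import numFieldNormedType.Exports.

Local Open Scope classical_set_scope.
Local Open Scope ring_scope.

(* Matrices carry the sigma-algebra generated by their entries, that is, the
   Borel sigma-algebra of R^(m * n). *)
Section matrix_measurable.
Context (R : realType) (m n : nat).

Definition mx_entry (i : 'I_m) (j : 'I_n) (A : 'M[R]_(m, n)) : R := A i j.

Definition mx_measurable : set (set 'M[R]_(m, n)) :=
  <<s \bigcup_(ij in [set: 'I_m * 'I_n])
        preimage_set_system setT (mx_entry ij.1 ij.2) measurable >>.

Let mx_measurable0 : mx_measurable set0.
Proof. exact: sigma_algebra0. Qed.

Let mx_measurableC A : mx_measurable A -> mx_measurable (~` A).
Proof. exact: sigma_algebraC. Qed.

Let mx_measurable_bigcup (F : (set 'M[R]_(m, n))^nat) :
  (forall i, mx_measurable (F i)) -> mx_measurable (\bigcup_i (F i)).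
Proof. exact: sigma_algebra_bigcup. Qed.

Definition mx_display : measure_display.
Proof. exact: (sigma_display mx_measurable). Qed.

HB.instance Definition _ := @isMeasurable.Build mx_display 'M[R]_(m, n)
  mx_measurable mx_measurable0 mx_measurableC mx_measurable_bigcup.

End matrix_measurable.

Section product_of_measures.
Context d (T : measurableType d) (R : realType).
Local Open Scope ereal_scope.

Section step.
Context n (m1 : {sigma_finite_measure set T -> \bar R})
  (m2 : {sigma_finite_measure set (n.-tuple T) -> \bar R}).

Definition cons_pair (x : T * n.-tuple T) : n.+1.-tuple T :=
  [tuple of x.1 :: x.2].

Lemma measurable_cons_pair : measurable_fun [set: T * n.-tuple T] cons_pair.
Proof. exact: (measurable_cons measurable_fst measurable_snd). Qed.

Definition cons_measure : set (n.+1.-tuple T) -> \bar R :=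
  pushforward (m1 \x m2) cons_pair.

Let cons_measure0 : cons_measure set0 = 0.
Proof. by rewrite /cons_measure /pushforward preimage_set0 measure0. Qed.

Let cons_measure_ge0 A : 0 <= cons_measure A.
Proof. exact: (measure_ge0 (m1 \x m2)). Qed.

Let cons_measure_sigma_additive : semi_sigma_additive cons_measure.
Proof.
exact: (@measure_semi_sigma_additive _ _ _
  (measure_function_pushforward__canonical__measure_function_Measure (m1 \x m2)
     measurable_cons_pair)).
Qed.

HB.instance Definition _ := isMeasure.Build _ _ _ cons_measure
  cons_measure0 cons_measure_ge0 cons_measure_sigma_additive.

Let cons_measure_sigma_finite : sigma_finite setT cons_measure.
Proof.
have /sigma_finiteP[F [TF ndF Foo]] := sigma_finiteT m1.
have /sigma_finiteP[G [TG ndG Goo]] := sigma_finiteT m2.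
pose g (t : n.+1.-tuple T) : T * n.-tuple T := (thead t, [tuple of behead t]).
have mg : measurable_fun setT g.
  by apply/measurable_fun_pair => /=;
    [exact: measurable_tnth|exact: measurable_behead].
have gK x : g (cons_pair x) = x.
  by case: x => a t; rewrite /g theadE; congr pair; exact/val_inj.
exists (fun k => g @^-1` (F k `*` G k)).
  apply/esym/seteqP; split => // t _.
  have [i _ Fi] : (\bigcup_i F i) (thead t) by rewrite -TF.
  have [j _ Gj] : (\bigcup_j G j) [tuple of behead t] by rewrite -TG.
  exists (maxn i j) => //; split => /=.
  - by move: Fi; exact/subsetPset/ndF/leq_maxl.
  - by move: Gj; exact/subsetPset/ndG/leq_maxr.
move=> k; have [mF Fk] := Foo k; have [mG Gk] := Goo k; split.
  by rewrite -[X in measurable X]setTI; apply: mg => //; exact: measurableX.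
rewrite /cons_measure /pushforward -comp_preimage.
rewrite (_ : g \o cons_pair = id); last exact/funext.
by rewrite preimage_id product_measure1E// lte_mul_pinfty// ge0_fin_numE.
Qed.

HB.instance Definition _ := Measure_isSigmaFinite.Build _ _ _ cons_measure
  cons_measure_sigma_finite.

End step.

(* The product of the n measures mu i, as a measure on n-tuples; see
   prod_measureE for its values on rectangles. *)
Fixpoint prod_measure n : ('I_n -> {sigma_finite_measure set T -> \bar R}) ->
    {sigma_finite_measure set (n.-tuple T) -> \bar R} :=
  match n with
  | 0 => fun=> \d_[tuple]
  | n'.+1 => fun mu =>
      cons_measure (mu ord0) (prod_measure (fun i => mu (lift ord0 i)))
  end.

Lemma prod_measureE n (mu : 'I_n -> {sigma_finite_measure set T -> \bar R})
    (A : 'I_n -> set T) : (forall i, measurable (A i)) ->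
  prod_measure mu [set t | forall i, A i (tnth t i)] = \prod_(i < n) mu i (A i).
Proof.
elim: n mu A => [|n IHn] mu A mA /=.
  by rewrite big_ord0 diracE mem_set//= => -[].
rewrite big_ord_recl -IHn// -product_measure1E//.
  congr ((_ \x _) _); apply/seteqP; split => -[x t] /=.
    by move=> At; split=> [|i]; [exact: (At ord0)|
      have := At (lift ord0 i); rewrite tnthS].
  move=> [Ax At] i; have [j ->|->] := unliftP ord0 i; last exact: Ax.
  by rewrite tnthS; exact: At.
rewrite (_ : mkset _ = \bigcap_(i in [set: 'I_n])
    ((@tnth n T ^~ i) @^-1` A (lift ord0 i))); last first.
  by apply/seteqP; split => t /= At i *; exact: At.
apply: fin_bigcap_measurable => // i _; rewrite -[X in measurable X]setTI.
exact: measurable_tnth.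
Qed.

End product_of_measures.


Section euclidean.
Context (R : realType).

(* The library norm on matrices is the sup norm; this is the Euclidean one. *)
Definition enorm n (u : 'cV[R]_n) : R := Num.sqrt (\sum_i u i 0 ^+ 2).

(* Lebesgue measure of R^n, transported from n-tuples to column vectors. *)
Definition lebesgue_cV n (A : set 'cV[R]_n) : \bar R :=
  prod_measure (fun _ : 'I_n => @lebesgue_measure R)
    [set t | A (\col_i tnth t i)].

Lemma lebesgue_cV_box n (a b : 'cV[R]_n) : (forall i, a i 0 <= b i 0) ->
  lebesgue_cV [set x | forall i, x i 0 \in `[a i 0, b i 0]] =
  (\prod_i (b i 0 - a i 0))%:E.
Proof.
move=> ab; rewrite /lebesgue_cV.
pose A (i : 'I_n) : set R := [set` `[a i 0, b i 0]].
have mA i : measurable (A i) by exact: measurable_itv.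
have E := prod_measureE (fun=> @lebesgue_measure R) mA.
transitivity (\prod_(i < n) (@lebesgue_measure R) (A i))%E; last first.
  rewrite -prodEFin; apply: eq_bigr => i _.
  by rewrite lebesgue_measure_itv/= lte_fin; case: ltgtP (ab i) => // ->;
    rewrite subrr.
rewrite -E; congr (prod_measure _ _).
by apply/seteqP; split => t /= At i; have := At i; rewrite mxE.
Qed.

Definition has_mean_cov n (P : probability 'cV[R]_n R)
    (m : 'cV[R]_n) (C : 'M[R]_n) : Prop :=
  [/\ forall i : 'I_n, mx_entry i 0 \in Lfun P 2%:E,
      forall i : 'I_n, ('E_P[mx_entry i 0%R] = (m i 0)%:E)%E &
      forall i j : 'I_n,
        covariance P (mx_entry i 0) (mx_entry j 0) = (C i j)%:E].

(* Total variation, normalised as the supremum over events (no factor 2). *)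
Definition tv_dist d (T : measurableType d) (mu nu : set T -> \bar R) : \bar R :=
  ereal_sup [set `|mu A - nu A|%E | A in measurable].

End euclidean.

Section EAKF.
Context (R : realType) (d q K : nat) (H : 'M[R]_(q, d)).

Definition ens_mean (V : 'M[R]_(d, K)) : 'cV[R]_d :=
  K%:R^-1 *: \sum_(k < K) col k V.

Definition ens_dev (V : 'M[R]_(d, K)) : 'M[R]_(d, K) :=
  \matrix_(i, k) (V i k - ens_mean V i 0).

Definition ens_cov (V : 'M[R]_(d, K)) : 'M[R]_d :=
  (K%:R - 1)^-1 *: (ens_dev V *m (ens_dev V)^T).

Definition descending p (l : 'rV[R]_p) : Prop :=
  forall i j : 'I_p, (i <= j)%N -> l 0 j <= l 0 i.

Definition reduced_svd p (S : 'M[R]_(d, K))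
    (Q1 : 'M[R]_(d, p)) (l : 'rV[R]_p) (R1 : 'M[R]_(p, K)) : Prop :=
  [/\ Q1^T *m Q1 = 1%:M, R1 *m R1^T = 1%:M,
      (forall i, 0 < l 0 i), descending l &
      S = Q1 *m diag_mx l *m R1].

Definition eigen_decomposition p (A G : 'M[R]_p) (D : 'rV[R]_p) : Prop :=
  [/\ G^T *m G = 1%:M, (forall i, 0 <= D 0 i), descending D &
      G^T *m diag_mx D *m G = A].

(* S is an admissible spread matrix for the forecast ensemble V: it is obtained
   from some reduced SVD of the deviations and some ordered eigenvalue
   decomposition. If the deviations vanish then p = 0 and S = 0. *)
Definition eakf_spread (V : 'M[R]_(d, K)) (S : 'M[R]_(d, K)) : Prop :=
  let p := \rank (ens_dev V) in
  exists (Q1 : 'M[R]_(d, p)) (l : 'rV[R]_p) (R1 : 'M[R]_(p, K))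
         (G1 : 'M[R]_p) (D1 : 'rV[R]_p),
    [/\ reduced_svd (ens_dev V) Q1 l R1,
        eigen_decomposition ((K%:R - 1)^-1 *:
          (diag_mx l *m Q1^T *m H^T *m H *m Q1 *m diag_mx l)) G1 D1 &
        S = Q1 *m diag_mx l *m G1^T
              *m diag_mx (map_mx (fun x => (Num.sqrt (1 + x))^-1) D1) *m R1].

Definition eakf_mean (V : 'M[R]_(d, K)) (z : 'cV[R]_q) : 'cV[R]_d :=
  let C := ens_cov V in
  ens_mean V - C *m H^T *m invmx (1%:M + H *m C *m H^T)
                 *m (H *m ens_mean V - z).

(* As S is asserted to exist for every input (u, V, z), Gamma embodies one fixed
   but arbitrary choice of decompositions for every input. *)
Definition eakf_update_map
    (Gamma : 'cV[R]_d * 'M[R]_(d, K) * 'cV[R]_q -> 'cV[R]_d * 'M[R]_(d, K)) :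
    Prop :=
  measurable_fun setT Gamma /\
  forall u V z, exists2 S, eakf_spread V S &
    Gamma (u, V, z) = (u, \matrix_(i, k) (eakf_mean V z i 0 + S i k)).

End EAKF.

(* One step of the chain from the state x = (u, v_1, ..., v_K) uses independent
   noises: zeta with law Q u, xi with law N, and zeta_k with law Q v_k. They are
   grouped as ((zeta, xi), (zeta_1, ..., zeta_K)). *)
Section filter_process.
Context (R : realType) (d q K : nat) (H : 'M[R]_(q, d)).
Local Notation state := ('cV[R]_d * 'M[R]_(d, K))%type.
Context (Gamma : 'cV[R]_d * 'M[R]_(d, K) * 'cV[R]_q -> state)
  (Psi : 'cV[R]_d -> 'cV[R]_d)
  (Q : 'cV[R]_d -> probability 'cV[R]_d R)
  (N : probability 'cV[R]_q R).
Local Open Scope ereal_scope.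

Definition noise_law (x : state) :
    {measure set ('cV[R]_d * 'cV[R]_q * K.-tuple 'cV[R]_d) -> \bar R} :=
  (Q x.1 \x N) \x prod_measure (fun k : 'I_K => Q (col k x.2)).

Definition filter_step (x : state)
    (w : 'cV[R]_d * 'cV[R]_q * K.-tuple 'cV[R]_d) : state :=
  let: (zeta, xi, zetas) := w in
  let u := (Psi x.1 + zeta)%R in
  let V := \matrix_(i, k) (Psi (col k x.2) i 0 + tnth zetas k i 0)%R in
  Gamma (u, V, (H *m u + xi)%R).

(* The transition kernel of X_n. *)
Definition transition (x : state) (A : set state) : \bar R :=
  noise_law x (filter_step x @^-1` A).

(* E(f(X_n) | X_(n-1) = x), the integral of f against transition x. *)
Definition next_expectation (f : state -> \bar R) (x : state) : \bar R :=
  \int[noise_law x]_w f (filter_step x w).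

(* P(X_n \in A | X_0 = x), by conditioning on X_1. *)
Fixpoint n_step (n : nat) (x : state) (A : set state) : \bar R :=
  if n is n'.+1 then next_expectation (n_step n' ^~ A) x else \d_x A.

(* The law of X_n when X_0 has law mu. *)
Definition law_at (mu : probability state R) (n : nat) (A : set state) :=
  \int[mu]_x n_step n x A.

Definition invariant_law (pi : probability state R) : Prop :=
  forall A, measurable A -> \int[pi]_x transition x A = pi A.

Definition kinetic_energy_principle (Rh : 'cV[R]_d -> 'M[R]_d) : Prop :=
  exists beta Kh : R, [/\ (0 < beta < 1)%R, (0 < Kh)%R &
    forall u, (enorm (Psi u) ^+ 2 + \tr (Rh u) <=
               (1 - beta) * enorm u ^+ 2 + Kh)%R].

Definition nondegenerate_noise : Prop :=
  forall M1 M2 : R, (0 < M1)%R -> (0 < M2)%R ->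
    exists2 alpha : R, (0 < alpha)%R &
      forall u, (enorm u <= M1)%R -> forall A, measurable A ->
        alpha%:E * lebesgue_cV (A `&` [set x | (enorm x <= M2)%R]) <= Q u A.

Definition strong_lyapunov (E : state -> R) : Prop :=
  [/\ (forall x, 0 <= E x)%R,
      (forall M : R, compact [set x | (E x <= M)%R]) &
      exists beta c : R, [/\ (0 < beta < 1)%R, (0 < c)%R &
        forall x, next_expectation (EFin \o E) x <= ((1 - beta) * E x + c)%:E]].

Definition geometrically_ergodic (E : state -> R) : Prop :=
  exists pi : probability state R,
    [/\ invariant_law pi,
        (forall pi' : probability state R, invariant_law pi' ->
           forall A, measurable A -> pi' A = pi A) &
        exists r kappa : R, [/\ (0 < r < 1)%R, (0 < kappa)%R &
          forall (mu : probability state R) (n : nat),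
            tv_dist (law_at mu n) pi <=
              (kappa * r ^+ n)%:E * (1 + \int[mu]_x (E x)%:E)]].

End filter_process.

(* Main.v *)
(** An EAKF update map must choose an SVD and an eigenvalue decomposition
    measurably.  For a fixed rank the admissible orthogonal factors form a
    compact set and determine the diagonal ones, so the relation between
    forecast and choice is closed; minimising the entries of the spread matrix
    one after the other over this compact-valued relation selects a measurable
    spread.

    No regularity of this map beyond measurability is needed for ergodicity.
    Sublevel sets of the Lyapunov function are bounded, and from a bounded set
    the noise makes the joint law of signal and forecast ensemble dominate a
    multiple of a fixed product measure (uniform on unit boxes, times the
    observation noise).  Its image under the assimilation map minorizes the
    transition kernel after a single step, and Harris' theorem applies, in the
    form of Hairer and Mattingly: the transition operator contracts the
    oscillation of functions weighted by the Lyapunov function. *)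

Require Import Defs.
From HB Require Import structures.
From mathcomp Require Import all_boot all_order all_algebra.
From mathcomp Require Import all_classical all_reals all_analysis.
From mathcomp Require Import measurable_realfun ring lra.

Set Implicit Arguments.
Unset Strict Implicit.
Unset Printing Implicit Defensive.

Import Order.TTheory GRing.Theory Num.Theory.
Import numFieldNormedType.Exports.

Local Open Scope classical_set_scope.
Local Open Scope ring_scope.

(** Eigenvectors may jump where eigenvalues cross and where the rank of the deviations changes, so a
    continuous choice of decompositions is not to be expected. The rank is split off, and for each
    rank only closedness of the admissible relation is used.

    The Lyapunov function and the kinetic energy bound have separate tasks: the first brings the
    chain back to bounded sets, the second bounds [Psi] on them, so that one ball of noise covers
    the unit box as seen from every forecast centre.

    The invariant law is not sought in a complete space of measures. Contraction of oscillations
    makes [P^n f] at one base state a Cauchy sequence, at a geometric rate that depends on [f] only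
    through its bound. The limit is a positive normalised functional of [f], and the uniform rate
    allows limits to be exchanged, which yields countable additivity. *)

(** * Continuity and compactness for matrices *)

Section matrix_continuity.
Context (R : realType).

Lemma cvg_mx (I : Type) (F : set_system I) (FF : Filter F) m n
    (f : I -> 'M[R]_(m, n)) (A : 'M[R]_(m, n)) :
  (forall i j, f x i j @[x --> F] --> A i j) -> f x @[x --> F] --> A.
Proof.
move=> fA S [P AP PS].
have : \forall x \near F, forall ij : 'I_m * 'I_n, P ij.1 ij.2 (f x ij.1 ij.2).
  by apply: filter_forall => -[i j] /=; apply: fA; exact: AP.
by apply: filterS => x fx; apply: PS => i j; exact: (fx (i, j)).
Qed.

Context (T : topologicalType).

Definition mx_continuous m n (f : T -> 'M[R]_(m, n)) :=
  forall i j, continuous (fun x => f x i j).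

Lemma mx_continuousP m n (f : T -> 'M[R]_(m, n)) :
  mx_continuous f -> continuous f.
Proof. by move=> cf x; apply: cvg_mx => i j; exact: cf. Qed.

Lemma continuous_mx m n (f : T -> 'M[R]_(m, n)) :
  continuous f -> mx_continuous f.
Proof.
move=> cf i j x.
by apply: (@continuous_comp T _ _ f (fun M : 'M[R]_(m, n) => M i j));
  [exact: cf|exact: coord_continuous].
Qed.

Lemma mx_continuous_cst m n (A : 'M[R]_(m, n)) : mx_continuous (fun=> A).
Proof. by move=> i j x; exact: cvg_cst. Qed.

Lemma continuous_sum (I : finType) (f : I -> T -> R) :
  (forall i, continuous (f i)) -> continuous (fun x => \sum_i f i x).
Proof.
by move=> cf; apply: continuous_big => //; exact: add_continuous.
Qed.

Lemma mx_continuousM m n p (f : T -> 'M[R]_(m, n)) (g : T -> 'M[R]_(n, p)) :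
  mx_continuous f -> mx_continuous g -> mx_continuous (fun x => f x *m g x).
Proof.
move=> cf cg i j; rewrite (_ : (fun x => _) =
  (fun x => \sum_k f x i k * g x k j)); last by apply/funext => x; rewrite mxE.
by apply: continuous_sum => k x; apply: cvgM; [exact: cf|exact: cg].
Qed.

Lemma mx_continuousT m n (f : T -> 'M[R]_(m, n)) :
  mx_continuous f -> mx_continuous (fun x => (f x)^T).
Proof.
move=> cf i j; rewrite (_ : (fun x => _) = (fun x => f x j i)); first exact: cf.
by apply/funext => x; rewrite mxE.
Qed.

Lemma mx_continuousZ m n c (f : T -> 'M[R]_(m, n)) :
  mx_continuous f -> mx_continuous (fun x => c *: f x).
Proof.
move=> cf i j; rewrite (_ : (fun x => _) = (fun x => c * f x i j)); last first.
  by apply/funext => x; rewrite mxE.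
by move=> x; apply: cvgM; [exact: cvg_cst|exact: cf].
Qed.

Lemma mx_continuous_diag n (f : T -> 'rV[R]_n) :
  mx_continuous f -> mx_continuous (fun x => diag_mx (f x)).
Proof.
move=> cf i j; rewrite (_ : (fun x => _) = (fun x => f x 0 i *+ (i == j))).
  by case: (i == j) => x; [exact: cf|exact: cvg_cst].
by apply/funext => x; rewrite mxE.
Qed.

Lemma closed_eq_mx m n (f g : T -> 'M[R]_(m, n)) :
  mx_continuous f -> mx_continuous g -> closed [set x | f x = g x].
Proof.
move=> cf cg; rewrite (_ : [set x | _] = \bigcap_(ij in [set: 'I_m * 'I_n])
    [set x | f x ij.1 ij.2 = g x ij.1 ij.2]); last first.
  apply/seteqP; split => x /= fg; first by move=> ij _ /=; rewrite fg.
  by apply/matrixP => i j; exact: (fg (i, j)).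
apply: closed_bigI => -[i j] _ /=.
rewrite (_ : [set x | _] = (fun x => f x i j - g x i j) @^-1` [set 0]).
  apply: preimage_closed; last exact: closed_eq.
  by move=> x _; apply: cvgB; [exact: cf|exact: cg].
by apply/seteqP; split => x /= /eqP; rewrite ?subr_eq0 => /eqP //;
  move=> ->; rewrite subrr.
Qed.

Lemma closed_le_fun (f g : T -> R) : continuous f -> continuous g ->
  closed [set x | f x <= g x].
Proof.
move=> cf cg.
rewrite (_ : [set x | _] = (fun x => g x - f x) @^-1` [set y | 0 <= y]).
  apply: preimage_closed; last exact: closed_ge.
  by move=> x _; apply: cvgB; [exact: cg|exact: cf].
by apply/seteqP; split => x /=; rewrite subr_ge0.
Qed.

End matrix_continuity.

(** [vec_mx] carries the compact box of row vectors with entries in [[- B, B]] continuously onto a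
    set of matrices that contains the closed set [A]. *)
Lemma compact_mx (R : realType) m n (A : set 'M[R]_(m, n)) (B : R) :
  closed A -> (forall M, A M -> forall i j, `|M i j| <= B) -> compact A.
Proof.
move=> cA AB.
pose C := [set v : 'rV[R]_(m * n) | forall i, v ord0 i \in `[- B, B]].
have cC : compact C.
  apply: (@rV_compact _ _ (fun=> `[- B, B]%classic)).
  by move=> _; exact: segment_compact.
have cv : continuous (@vec_mx R m n).
  apply: mx_continuousP => i j; rewrite (_ : (fun x => _) =
    (fun x : 'rV_(m * n) => x 0 (mxvec_index i j))).
    by move=> x; exact: coord_continuous.
  by apply/funext => x; rewrite mxE.
have cD : compact (@vec_mx R m n @` C).
  by apply: continuous_compact => //; exact: continuous_subspaceT.
apply: (subclosed_compact cA cD) => M AM; exists (mxvec M); last by rewrite mxvecK.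
by move=> k; case/mxvec_indexP: k => i j; rewrite mxvecE in_itv/= -ler_norml AB.
Qed.

Lemma compact_orthonormal_rows (R : realType) m n :
  compact [set M : 'M[R]_(m, n) | M *m M^T = 1%:M].
Proof.
apply: (@compact_mx _ _ _ _ 1).
  apply: closed_eq_mx; last exact: mx_continuous_cst.
  have cid : mx_continuous (@id 'M[R]_(m, n)) by apply: continuous_mx => x; exact: cvg_id.
  by apply: mx_continuousM => //; exact: mx_continuousT.
move=> M /= MM i j; rewrite -[leRHS]ger0_norm// -ler_sqr ?nnegrE//.
rewrite real_normK ?num_real// normr1 expr1n.
have := congr1 (fun A : 'M[R]_m => A i i) MM; rewrite !mxE eqxx mulr1n => <-.
rewrite (bigD1 j)//= mxE -expr2 lerDl sumr_ge0// => k _.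
by rewrite mxE -expr2 sqr_ge0.
Qed.

(** * Spectral theorem and singular values *)

Section spectral.
Context (R : realType).

(** Row [k] of the rotation by [(c, s)] in the plane of [i] and [j]. Every branch, even the identity
    one, is a combination of two basis vectors, so that [bilinear_deltaD] computes all entries of a
    conjugated matrix. *)
Definition givens_row n (i j : 'I_n) (c s : R) (k : 'I_n) : 'rV[R]_n :=
  if k == i then c *: delta_mx 0 i + s *: delta_mx 0 j
  else if k == j then c *: delta_mx 0 j + (- s) *: delta_mx 0 i
  else 1 *: delta_mx 0 k + 0 *: delta_mx 0 k.

Definition givens n (i j : 'I_n) (c s : R) : 'M[R]_n :=
  \matrix_(k < n) givens_row i j c s k.

Lemma congr_entry n (P B : 'M[R]_n) k l :
  (P *m B *m P^T) k l = (row k P *m B *m (row l P)^T) 0 0.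
Proof.
rewrite !mxE; apply: eq_bigr => b _; rewrite !mxE; congr (_ * _).
by apply: eq_bigr => a _; rewrite !mxE.
Qed.

Lemma bilinear_delta n (B : 'M[R]_n) k l :
  delta_mx 0 k *m B *m (delta_mx 0 l)^T = (B k l)%:M :> 'M[R]_1.
Proof.
by rewrite trmx_delta -rowE -colE; apply/matrixP => a b; rewrite !ord1 !mxE.
Qed.

Lemma bilinear_deltaD n (B : 'M[R]_n) a b a' b' k l k' l' :
  ((a *: delta_mx 0 k + b *: delta_mx 0 l : 'rV_n) *m B *m
   (a' *: delta_mx 0 k' + b' *: delta_mx 0 l' : 'rV_n)^T) 0 0 =
  a * a' * B k k' + a * b' * B k l' + b * a' * B l k' + b * b' * B l l' :> R.
Proof.
rewrite !linearD/= !linearZ/= ?(mulmxDl, mulmxDr) -?scalemxAl.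
by rewrite !bilinear_delta !mxE eqxx !mulr1n; ring.
Qed.

Lemma givensE n (i j : 'I_n) c s (B : 'M[R]_n) k l :
  (givens i j c s *m B *m (givens i j c s)^T) k l =
  (givens_row i j c s k *m B *m (givens_row i j c s l)^T) 0 0.
Proof. by rewrite congr_entry !rowK. Qed.

Lemma givens_other n (i j : 'I_n) c s (B : 'M[R]_n) k :
  k != i -> k != j ->
  (givens i j c s *m B *m (givens i j c s)^T) k k = B k k.
Proof.
move=> /negbTE ki /negbTE kj.
by rewrite givensE /givens_row ki kj bilinear_deltaD; ring.
Qed.

Lemma givens_fst n (i j : 'I_n) c s (B : 'M[R]_n) :
  (givens i j c s *m B *m (givens i j c s)^T) i i =
  c * c * B i i + c * s * B i j + s * c * B j i + s * s * B j j.
Proof. by rewrite givensE /givens_row eqxx bilinear_deltaD. Qed.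

Lemma givens_snd n (i j : 'I_n) c s (B : 'M[R]_n) : i != j ->
  (givens i j c s *m B *m (givens i j c s)^T) j j =
  c * c * B j j - c * s * B j i - s * c * B i j + s * s * B i i.
Proof.
move=> ij.
by rewrite givensE /givens_row eq_sym (negbTE ij) eqxx bilinear_deltaD; ring.
Qed.

Lemma givens_orthogonal n (i j : 'I_n) c s : i != j -> c * c + s * s = 1 ->
  givens i j c s *m (givens i j c s)^T = 1%:M.
Proof.
move=> ij cs; apply/matrixP => k l.
rewrite -{1}[givens i j c s]mulmx1 givensE /givens_row.
have ji : (j == i) = false by rewrite eq_sym (negbTE ij).
case: (eqVneq k i) => [->|ki]; last case: (eqVneq k j) => [->|kj];
  (case: (eqVneq l i) => [->|li]; last case: (eqVneq l j) => [->|lj]).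
all: rewrite bilinear_deltaD !mxE ?eqxx ?(negbTE ij) ?ji.
all: rewrite ?(negbTE ki) ?(negbTE kj) ?(negbTE li) ?(negbTE lj).
all: rewrite ?[i == l]eq_sym ?[j == l]eq_sym ?(negbTE li) ?(negbTE lj).
all: rewrite ?mulr1n ?mulr0n.
all: first [by ring | by rewrite -[RHS]cs; ring].
Qed.

(* The maximisers over the orthogonal group of a trace weighted by strictly
   decreasing weights diagonalise A: a plane rotation would increase it. *)
Lemma spectral_theorem n (A : 'M[R]_n) : A^T = A ->
  exists G : 'M[R]_n, exists D : 'rV[R]_n,
    [/\ G *m G^T = 1%:M, descending D & G *m A *m G^T = diag_mx D].
Proof.
move=> AT; pose phi (G : 'M[R]_n) : R := \sum_(i < n) - (i%:R) * (G *m A *m G^T) i i.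
have [G [GG Gmax]] : exists G : 'M[R]_n, G *m G^T = 1%:M /\
    forall P : 'M[R]_n, P *m P^T = 1%:M -> phi P <= phi G.
  have [||G] := @compact_EVT_max _ R phi _ _ (@compact_orthonormal_rows R n n).
  - by exists 1%:M; rewrite /= trmx1 mulmx1.
  - apply: continuous_subspaceT.
    have cid : mx_continuous (@id 'M[R]_n).
      by apply: continuous_mx => x; exact: cvg_id.
    have cM : mx_continuous (fun G : 'M[R]_n => G *m A *m G^T).
      apply: mx_continuousM; last exact: mx_continuousT.
      by apply: mx_continuousM => //; exact: mx_continuous_cst.
    rewrite /phi; apply: continuous_sum => i x.
    apply: (@cvgM _ _ (nbhs x) _ (fun=> - i%:R)
      (fun G : 'M[R]_n => (G *m A *m G^T) i i)); first exact: cvg_cst.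
    exact: (cM i i x).
  - rewrite inE/= => GG Gmax; exists G; split => // P PP.
    by apply: Gmax; rewrite inE.
have [M ME] : exists M, M = G *m A *m G^T by eexists.
have MT : M^T = M by rewrite ME !trmx_mul trmxK AT mulmxA.
have Msym i j : M j i = M i j by rewrite -[in RHS]MT [RHS]mxE.
(* The rotation adds [s * s * (M j j - M i i) + 2 * (c * s * M i j)] to diagonal entry [i], takes it
   from entry [j] and fixes the other diagonal entries, so [phi] grows by [j - i] times this amount,
   which cannot be positive at a maximiser. *)
have rot (i j : 'I_n) c s : (i < j)%N -> c * c + s * s = 1 ->
    s * s * (M j j - M i i) + 2 * (c * s * M i j) <= 0.
  move=> ij cs; have nij : i != j by rewrite neq_ltn ij.
  have PP := givens_orthogonal nij cs.
  have /Gmax : (givens i j c s *m G) *m (givens i j c s *m G)^T = 1%:M.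
    by rewrite trmx_mul mulmxA -(mulmxA _ G) GG mulmx1.
  have PGE : (givens i j c s *m G) *m A *m (givens i j c s *m G)^T =
      givens i j c s *m M *m (givens i j c s)^T.
    by rewrite trmx_mul ME !mulmxA.
  have split2 (F : 'I_n -> R) : \sum_k F k =
      F i + (F j + \sum_(k | (k != i) && (k != j)) F k).
    by rewrite (bigD1 i)// (bigD1 j) 1?eq_sym.
  rewrite /phi PGE -ME !split2.
  rewrite givens_fst givens_snd// Msym.
  under eq_bigr => k /andP[ki kj] do rewrite givens_other//.
  rewrite !addrA lerD2r => le1.
  have ij0 : 0 < j%:R - i%:R :> R by rewrite subr_gt0 ltr_nat.
  have cE : c * c = 1 - s * s by rewrite -cs addrK.
  rewrite -(pmulr_rle0 _ ij0).
  by move: le1; rewrite cE; nra.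
exists G, (\row_i M i i); split => //.
  (* The rotation with [c = 0], [s = 1] exchanges two diagonal entries. *)
  move=> i j; rewrite leq_eqVlt => /predU1P[/val_inj->//|ij]; rewrite !mxE.
  by have := rot i j 0 1 ij; rewrite !(mulr0, mul0r, mulr1, mul1r, add0r, addr0) subr_le0;
    apply.
have M0 (i j : 'I_n) : (i < j)%N -> M i j = 0.
  move=> ij; apply/eqP; case: eqVneq => // b0.
  (* For the unit vector [(c, s)] along [(X, 1)], this [X] turns the left side of [rot] into
     [(x + 2 * X * M i j) / r^2 = 1 / r^2], which is positive. *)
  pose x := M j j - M i i; pose X := (1 - x) / (2 * M i j).
  have XE : 2 * (X * M i j) = 1 - x by rewrite /X; field.
  have N0 : 0 < X * X + 1 by rewrite ltr_wpDl// -expr2 sqr_ge0.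
  pose r := Num.sqrt (X * X + 1).
  have r0 : 0 < r by rewrite sqrtr_gt0.
  have rr : r * r = X * X + 1 by rewrite -expr2 sqr_sqrtr// ltW.
  have := rot i j (X / r) r^-1 ij.
  have -> : X / r * (X / r) + r^-1 * r^-1 = (X * X + 1) / (r * r).
    by field; rewrite gt_eqF.
  rewrite rr divff ?gt_eqF// => /(_ erefl).
  have -> : r^-1 * r^-1 * (M j j - M i i) + 2 * (X / r * r^-1 * M i j) =
      (x + 2 * (X * M i j)) / (r * r) by rewrite /x; field; rewrite gt_eqF.
  by rewrite XE addrC subrK rr mul1r invr_le0 leNgt N0.
rewrite -ME; apply/matrixP => i j; rewrite !mxE.
case: eqVneq => [->//|nij].
rewrite mulr0n; case: (ltngtP i j) => [/M0//|/M0|/val_inj/eqP]; last first.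
  by rewrite (negbTE nij).
by rewrite Msym.
Qed.

End spectral.

Section singular_values.
Context (R : realType).

Lemma gram_diag n m (B : 'M[R]_(n, m)) i :
  (B *m B^T) i i = \sum_k B i k ^+ 2.
Proof. by rewrite mxE; apply: eq_bigr => k _; rewrite mxE expr2. Qed.

Lemma psd_eigen_decomposition n m (B : 'M[R]_(n, m)) c : 0 <= c ->
  exists G D, eigen_decomposition (c *: (B *m B^T)) G D.
Proof.
move=> c0; have [|G [D [GG De GD]]] := @spectral_theorem R n (c *: (B *m B^T)).
  by rewrite linearZ/= trmx_mul trmxK.
have GtG : G^T *m G = 1%:M by exact: mulmx1C.
exists G, D; split => //; last first.
  by rewrite -GD !mulmxA GtG mul1mx -mulmxA GtG mulmx1.
move=> i; have <- : diag_mx D i i = D 0 i by rewrite mxE eqxx mulr1n.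
rewrite -GD -scalemxAr -scalemxAl mxE mulr_ge0//.
have -> : G *m (B *m B^T) *m G^T = (G *m B) *m (G *m B)^T.
  by rewrite trmx_mul !mulmxA.
rewrite gram_diag sumr_ge0// => k _.
exact: sqr_ge0.
Qed.

(** Diagonalise [B *m B^T]; the rows of [G *m B] are then orthogonal with squared lengths [D], and
    normalising them gives [Q]. A zero length would force a zero row of [G], because [B] is row
    free. *)
Lemma row_free_svd n m (B : 'M[R]_(n, m)) : row_free B ->
  exists (G : 'M[R]_n) (l : 'rV[R]_n) (Q : 'M[R]_(n, m)),
    [/\ G^T *m G = 1%:M, Q *m Q^T = 1%:M, forall i, 0 < l 0 i,
        descending l & B = G^T *m diag_mx l *m Q].
Proof.
move=> Bfree; have [G [D [GtG _ De GD]]] := psd_eigen_decomposition B ler01.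
rewrite scale1r in GD.
have GG : G *m G^T = 1%:M by exact: mulmx1C.
have GB : (G *m B) *m (G *m B)^T = diag_mx D.
  rewrite trmx_mul !mulmxA -(mulmxA G) -GD !mulmxA GG mul1mx.
  by rewrite -mulmxA GG mulmx1.
have D0 i : 0 < D 0 i.
  have DE : D 0 i = \sum_k (G *m B) i k ^+ 2.
    by rewrite -gram_diag GB mxE eqxx mulr1n.
  rewrite lt_def DE sumr_ge0 ?andbT => [|k _]; last exact: sqr_ge0.
  apply/negP; rewrite psumr_eq0 => [/allP GB0|k _]; last exact: sqr_ge0.
  have : row i G *m B = 0.
    rewrite -row_mul; apply/rowP => k; rewrite !mxE.
    by have := GB0 k (mem_index_enum _); rewrite mxE sqrf_eq0 => /eqP.
  move=> /eqP; rewrite mulmx_free_eq0// => /eqP Gi0.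
  have := congr1 (fun M : 'M[R]_n => M i i) GG.
  rewrite gram_diag mxE eqxx big1 => [/esym/eqP|k _]; first by rewrite oner_eq0.
  have := congr1 (fun M : 'rV[R]_n => M 0 k) Gi0; rewrite !mxE => ->.
  by rewrite expr0n.
pose l : 'rV[R]_n := \row_i Num.sqrt (D 0 i).
pose k : 'rV[R]_n := \row_i (Num.sqrt (D 0 i))^-1.
have s0 i : Num.sqrt (D 0 i) != 0 by rewrite gt_eqF// sqrtr_gt0.
have lk : diag_mx l *m diag_mx k = 1%:M.
  rewrite mulmx_diag; apply/matrixP => i j; rewrite !mxE.
  by case: eqVneq => [->|]; rewrite ?mulfV// mulr0n.
exists G, l, (diag_mx k *m (G *m B)); split => //.
- rewrite trmx_mul tr_diag_mx [LHS]mulmxA -(mulmxA (diag_mx k)) GB !mulmx_diag.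
  apply/matrixP => i j; rewrite !mxE; case: eqVneq => [->|]; last first.
    by rewrite mulr0n.
  have := s0 j; have := @sqr_sqrtr _ (D 0 j) (ltW (D0 j)).
  by set s := Num.sqrt _ => <- s_neq0; rewrite !mulr1n; field.
- by move=> i; rewrite mxE sqrtr_gt0.
- by move=> i j ij; rewrite !mxE ler_wsqrtr// De.
- by rewrite mulmxA -(mulmxA G^T) lk mulmx1 mulmxA GtG mul1mx.
Qed.

(** A rank factorisation reduces to matrices of full row rank, and [row_free_svd] is applied twice:
    to the transposed column factor, then to what is left once the orthonormal columns [Q^T] are
    split off. Only the second application provides the singular values of [S]. *)
Lemma reduced_svd_exists d K (S : 'M[R]_(d, K)) :
  exists (Q1 : 'M[R]_(d, \rank S)) l (R1 : 'M[R]_(\rank S, K)),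
    reduced_svd S Q1 l R1.
Proof.
have Cfree : row_free (col_base S)^T.
  by rewrite /row_free mxrank_tr; exact: col_base_full.
have [G1 [l1 [Q [GG1 QQ l1_gt0 _ CE]]]] := row_free_svd Cfree.
have Tfree : row_free (diag_mx l1 *m G1 *m row_base S).
  rewrite /row_free mxrankMfree ?row_base_free// -/(row_free _) row_free_unit.
  rewrite unitmx_mul; apply/andP; split; last by case: (mulmx1_unit GG1).
  by rewrite unitmxE det_diag unitfE prodf_seq_neq0; apply/allP => i _;
    rewrite gt_eqF.
have [G2 [l [R1 [GG2 RR l_gt0 De TE]]]] := row_free_svd Tfree.
have GG2' : G2 *m G2^T = 1%:M by exact: mulmx1C.
exists (Q^T *m G2^T), l, R1; split => //.
  by rewrite trmx_mul !trmxK !mulmxA -(mulmxA G2) QQ mulmx1.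
have CE' : col_base S = Q^T *m diag_mx l1 *m G1.
  by rewrite -[LHS]trmxK CE !trmx_mul tr_diag_mx trmxK mulmxA.
rewrite -[LHS]mulmx_base CE'; move: (row_base S) TE => B TE.
by rewrite -[RHS]mulmxA -[RHS]mulmxA (mulmxA G2^T) -TE !mulmxA.
Qed.

End singular_values.

(** * Measurability on spaces of matrices *)

Section matrix_sigma_algebra.
Context (R : realType).

Lemma measurable_mx_entry m n (i : 'I_m) (j : 'I_n) :
  measurable_fun setT (@mx_entry R m n i j).
Proof.
move=> _ A mA; rewrite setTI; apply: sub_sigma_algebra.
by exists (i, j) => //; exists A => //; rewrite setTI.
Qed.

Lemma measurable_fun_mx d (X : measurableType d) m n (f : X -> 'M[R]_(m, n)) :
  (forall i j, measurable_fun setT (fun x => f x i j)) -> measurable_fun setT f.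
Proof.
move=> mf; apply: (measurability (\bigcup_(ij in [set: 'I_m * 'I_n])
    preimage_set_system setT (@mx_entry R m n ij.1 ij.2) measurable)) => //.
move=> _ [_ [[i j] _] [A mA <-]] <-; rewrite setTI.
exact: (mf i j measurableT A mA).
Qed.

Lemma measurable_fun_mx_entry d (X : measurableType d) m n
    (f : X -> 'M[R]_(m, n)) i j :
  measurable_fun setT f -> measurable_fun setT (fun x => f x i j).
Proof.
by move=> mf; apply: (measurableT_comp (@measurable_mx_entry m n i j) mf).
Qed.

Lemma measurable_fun_le_sets d (X : measurableType d) (f : X -> R) :
  (forall t, measurable [set x | f x <= t]) -> measurable_fun setT f.
Proof.
move=> mf; apply: (measurability (@RGenOInfty.G R)).
  exact: RGenOInfty.measurableE.
move=> _ [_ [t ->] <-]; rewrite setTI -[X in measurable X]setCK.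
apply: measurableC; rewrite (_ : ~` _ = [set x | f x <= t]) //.
by apply/seteqP; split => x /=; rewrite in_itv/= andbT leNgt => /negP.
Qed.

Section mulmx.
Context d (X : measurableType d).

Lemma measurable_fun_mulmx m n p (f : X -> 'M[R]_(m, n)) (g : X -> 'M[R]_(n, p)) :
  measurable_fun setT f -> measurable_fun setT g ->
  measurable_fun setT (fun x => f x *m g x).
Proof.
move=> mf mg; apply: measurable_fun_mx => i j.
rewrite (_ : (fun x => _) = (fun x => \sum_k f x i k * g x k j)); last first.
  by apply/funext => x; rewrite mxE.
by apply: measurable_sum => k; apply: measurable_funM;
  exact: measurable_fun_mx_entry.
Qed.

Lemma measurable_fun_addmx m n (f g : X -> 'M[R]_(m, n)) :
  measurable_fun setT f -> measurable_fun setT g ->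
  measurable_fun setT (fun x => f x + g x).
Proof.
move=> mf mg; apply: measurable_fun_mx => i j.
rewrite (_ : (fun x => _) = (fun x => f x i j + g x i j)); last first.
  by apply/funext => x; rewrite mxE.
by apply: measurable_funD; exact: measurable_fun_mx_entry.
Qed.

Lemma measurable_fun_trmx m n (f : X -> 'M[R]_(m, n)) :
  measurable_fun setT f -> measurable_fun setT (fun x => (f x)^T).
Proof.
move=> mf; apply: measurable_fun_mx => i j.
rewrite (_ : (fun x => _) = (fun x => f x j i)); last first.
  by apply/funext => x; rewrite mxE.
exact: measurable_fun_mx_entry.
Qed.

Lemma measurable_fun_scalemx m n c (f : X -> 'M[R]_(m, n)) :
  measurable_fun setT f -> measurable_fun setT (fun x => c *: f x).
Proof.
move=> mf; apply: measurable_fun_mx => i j.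
rewrite (_ : (fun x => _) = (fun x => c * f x i j)); last first.
  by apply/funext => x; rewrite mxE.
by apply: measurable_funM; [exact: measurable_cst|exact: measurable_fun_mx_entry].
Qed.

Lemma measurable_fun_oppmx m n (f : X -> 'M[R]_(m, n)) :
  measurable_fun setT f -> measurable_fun setT (fun x => - f x).
Proof.
move=> mf; under eq_fun do rewrite -scaleN1r.
exact: measurable_fun_scalemx.
Qed.

Lemma measurable_det n (f : X -> 'M[R]_n) :
  measurable_fun setT f -> measurable_fun setT (fun x => \det (f x)).
Proof.
move=> mf; apply: measurable_sum => s.
apply: measurable_funM; first exact: measurable_cst.
by apply: measurable_prod => i _; exact: measurable_fun_mx_entry.
Qed.

Lemma measurable_fun_invr (f : X -> R) :
  measurable_fun setT f -> measurable_fun setT (fun x => (f x)^-1).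
Proof.
move=> mf; apply: (measurableT_comp _ mf) => {f mf}.
(* Inversion is continuous off [0]; the point [0], where its value is [0] by convention, is treated
   apart. *)
have : measurable_fun ([set 0 : R] `|` ~` [set 0 : R] : set R) (@GRing.inv R).
  apply/measurable_funU => //; first exact: measurableC.
  split; first exact: measurable_fun_set1.
  apply: open_continuous_measurable_fun.
    by apply: closed_openC; exact: closed_eq.
  by move=> x; rewrite inE/= => /eqP x0; exact: inv_continuous.
by rewrite setUv.
Qed.

Lemma measurable_fun_invmx n (f : X -> 'M[R]_n) :
  measurable_fun setT f -> measurable_fun setT (fun x => invmx (f x)).
Proof.
move=> mf; apply: measurable_fun_mx => i j.
(* [invmx] returns a singular matrix unchanged, which is the first branch; elsewhere Cramer's rule
   applies. *)
have E x : invmx (f x) i j =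
    if \det (f x) == 0 then f x i j else (\det (f x))^-1 * \adj (f x) i j.
  rewrite /invmx unitmxE unitfE; case: eqP => //= _.
  by rewrite mxE.
under eq_fun do rewrite E.
apply: measurable_fun_ifT; last 2 first.
- exact: measurable_fun_mx_entry.
- apply: measurable_funM; first exact/measurable_fun_invr/measurable_det.
  under eq_fun do rewrite mxE.
  apply: measurable_funM; first exact: measurable_cst.
  apply: measurable_det; apply: measurable_fun_mx => a b.
  under eq_fun do rewrite !mxE.
  exact: measurable_fun_mx_entry.
apply: measurable_fun_eqr; last exact: measurable_cst.
exact: measurable_det.
Qed.

End mulmx.

End matrix_sigma_algebra.

Section countable_base.

Definition nbhs_base (T : topologicalType) I (B : I -> set T) :=
  forall x U, nbhs x U -> exists2 i, B i x & B i `<=` U.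

(** An open set is the union of the countably many basic sets that it contains; the other indices
    contribute [set0]. *)
Lemma measurable_open d (T : topologicalType) (S : measurableType d) (I : countType)
    (B : I -> set T) (g : S -> T) : nbhs_base B ->
  (forall i, measurable (g @^-1` B i)) ->
  forall A, open A -> measurable (g @^-1` A).
Proof.
move=> Bb mB A oA.
rewrite (_ : _ @^-1` _ =
    \bigcup_(i : I) (if `[< B i `<=` A >] then g @^-1` B i else set0)).
  apply: countable_bigcupT_measurable; first exact: countableP.
  by move=> i; case: ifP.
apply/seteqP; split => [x Ax|x [i _]]; last by case: asboolP => // BA /BA.
have [i Bx BA] := Bb _ _ (open_nbhs_nbhs (conj oA Ax)).
by exists i => //; rewrite asboolT.
Qed.

Lemma measurable_closed d (T : topologicalType) (S : measurableType d) (I : countType)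
    (B : I -> set T) (g : S -> T) : nbhs_base B ->
  (forall i, measurable (g @^-1` B i)) ->
  forall A, closed A -> measurable (g @^-1` A).
Proof.
move=> Bb mB A cA; rewrite -[X in measurable X]setCK.
by apply: measurableC; rewrite preimage_setC; apply: measurable_open Bb mB _ _; exact: closed_openC.
Qed.

(** Rational bounds make the family countable. This ties the topology of matrices to the
    sigma-algebra generated by the entries, for which such boxes are measurable. *)
Definition rat_box (R : realType) m n (ab : 'M[rat]_(m, n) * 'M[rat]_(m, n)) :=
  [set M : 'M[R]_(m, n) | forall i j,
    ratr (ab.1 i j) < M i j < ratr (ab.2 i j)].

Lemma rat_box_base (R : realType) m n : nbhs_base (@rat_box R m n).
Proof.
move=> x U [P xP PU].
have H ij : exists ab : rat * rat,
    ratr ab.1 < x ij.1 ij.2 < ratr ab.2 /\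
    forall y : R, ratr ab.1 < y < ratr ab.2 -> P ij.1 ij.2 y.
  have /nbhs_ballP[e /= e0 eP] := xP ij.1 ij.2.
  have [a] : exists q : rat, ratr q \in `](x ij.1 ij.2 - e), (x ij.1 ij.2)[.
    by apply: rat_in_itvoo; rewrite ltrBlDr ltrDl.
  have [b] : exists q : rat, ratr q \in `](x ij.1 ij.2), (x ij.1 ij.2 + e)[.
    by apply: rat_in_itvoo; rewrite ltrDl.
  rewrite !in_itv/= => /andP[xb bx] /andP[ax xa].
  exists (a, b); split => /=; first by rewrite xa xb.
  move=> y /andP[ay yb]; apply: eP.
  by rewrite /ball/= ltr_distlC (lt_trans ax ay) (lt_trans yb bx).
have [ab Hab] := choice H.
exists (\matrix_(i, j) (ab (i, j)).1, \matrix_(i, j) (ab (i, j)).2).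
  by move=> i j; rewrite !mxE; exact: (Hab (i, j)).1.
move=> M Mab; apply: PU => i j; apply: (Hab (i, j)).2.
by have := Mab i j; rewrite !mxE.
Qed.

Lemma measurable_rat_box (R : realType) m n ab : measurable (@rat_box R m n ab).
Proof.
rewrite (_ : rat_box _ = \bigcap_(ij in [set: 'I_m * 'I_n])
  ((@mx_entry R m n ij.1 ij.2) @^-1`
   `]ratr (ab.1 ij.1 ij.2), ratr (ab.2 ij.1 ij.2)[)); last first.
  apply/seteqP; split => M /= H => [ij _|i j].
    by rewrite /= in_itv/=; exact: H.
  by have := H (i, j) I; rewrite /= in_itv.
apply: fin_bigcap_measurable => // ij _; rewrite -[X in measurable X]setTI.
by apply: measurable_mx_entry => //; exact: measurable_itv.
Qed.

Lemma measurable_closed_mx (R : realType) m n (A : set 'M[R]_(m, n)) :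
  closed A -> measurable A.
Proof.
move=> cA; apply: (measurable_closed (g := @idfun 'M[R]_(m, n))
  (@rat_box_base R m n) _ cA).
exact: measurable_rat_box.
Qed.

Lemma measurable_closed_mxX (R : realType) m n p q
    (A : set ('M[R]_(m, n) * 'M[R]_(p, q))) : closed A -> measurable A.
Proof.
move=> cA; apply: (@measurable_closed _ _ _ _
  (fun i => @rat_box R m n i.1 `*` @rat_box R p q i.2) (@idfun _) _ _ _ cA).
  move=> [x y] U [[/= V W]].
  move=> [Vx Wy] VWU; have [i ix iV] := rat_box_base Vx.
  have [j jy jW] := rat_box_base Wy.
  by exists (i, j) => //= -[a b] [/= /iV ? /jW ?]; exact: VWU.
by move=> i; apply: measurableX; exact: measurable_rat_box.
Qed.

End countable_base.

(** * Measurable selection *)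

Section selection.
Context (R : realType) (m n : nat) (Y : topologicalType).
Local Notation X := 'M[R]_(m, n).
Implicit Types (F : X -> set Y) (C : set (X * Y)) (phi : X * Y -> R).

(** The lower inverse image of a set-valued map, with the target allowed to vary with [x]. *)
Definition hits F C : set X := [set x | exists2 y, F x y & C (x, y)].

Definition measurable_compact_valued F :=
  (forall x, compact (F x)) /\ forall C, closed C -> measurable (hits F C).

Lemma closed_section C x : closed C -> closed [set y | C (x, y)].
Proof.
move=> cC; apply: (@preimage_closed _ _ (pair x) C) => // y _.
by apply: (@cvg_pair Y X Y (nbhs y) (nbhs x) (nbhs y) _ _ _ (fun=> x) id); [exact: cvg_cst|exact: cvg_id].
Qed.

(** Tube lemma: projection along a compact factor preserves closed sets. *)
Lemma closed_hits (O : set Y) C : compact O -> closed C ->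
  closed (hits (fun=> O) C).
Proof.
move=> cO cC; rewrite -openC openE => x0 /= nx0.
have /compact_near_coveringP/(_ X (nbhs x0) (fun x y => ~ C (x, y)) _) := cO.
have H : forall y, O y -> \forall y' \near y & x \near x0, ~ C (x, y').
  move=> y Oy; have oC : open (~` C) by exact: closed_openC.
  have /= [[U V] /= [xU yV] UV] : nbhs (x0, y) (~` C).
    by apply: open_nbhs_nbhs; split => // Cy; apply: nx0; exists y.
  by exists (V, U) => // -[y' x] [/= Vy Ux]; apply: UV.
move=> /(_ H); apply: filterS => x Ox [y /Ox + Cy]; exact.
Qed.

Lemma measurable_compact_valued_closed (O : set Y) C : compact O -> closed C ->
  measurable_compact_valued (fun x => [set y | O y /\ C (x, y)]).
Proof.
move=> cO cC; split=> [x|D cD].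
  rewrite (_ : mkset _ = O `&` [set y | C (x, y)])//.
  by apply: compact_closedI => //; exact: closed_section.
apply: measurable_closed_mx.
rewrite (_ : hits _ _ = hits (fun=> O) (C `&` D)).
  by apply: closed_hits => //; exact: closedI.
by apply/seteqP; split => x [y]; [move=> [Oy Cy] Dy|move=> Oy [Cy Dy]]; exists y.
Qed.

Definition argmin F phi x : set Y :=
  [set y | F x y /\ forall z, F x z -> phi (x, y) <= phi (x, z)].

Lemma continuous_section phi x : continuous phi ->
  continuous (fun y => phi (x, y)).
Proof.
move=> cphi y.
apply: (@continuous_comp _ _ _ (pair x) phi); last exact: cphi.
by apply: (@cvg_pair Y X Y (nbhs y) (nbhs x) (nbhs y) _ _ _ (fun=> x) id); [exact: cvg_cst|exact: cvg_id].
Qed.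

Lemma compact_min (K : set Y) (f : Y -> R) : compact K -> continuous f ->
  K !=set0 -> exists2 y, K y & forall z, K z -> f y <= f z.
Proof.
move=> cK cf K0; have [|y] := @compact_EVT_min Y R f K K0 cK.
  exact: continuous_subspaceT.
by rewrite inE => Ky ymin; exists y => // z Kz; apply: ymin; rewrite inE.
Qed.

Lemma argmin_nonempty F phi x : compact (F x) -> continuous phi ->
  F x !=set0 -> argmin F phi x !=set0.
Proof.
move=> cF /(@continuous_section _ x) cphi /(compact_min cF cphi)[y Fy ymin].
by exists y; split.
Qed.

Lemma closed_le_cst phi (t : R) : continuous phi ->
  closed [set xy | phi xy <= t].
Proof. by move=> cphi; apply: closed_le_fun => // x; exact: cvg_cst. Qed.

(* By compactness, C is hit by a minimiser of phi iff for every rational r,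
   C contains a point of F x with phi <= r as soon as F x has such a point. *)
Lemma hits_argmin F phi C : (forall x, compact (F x)) -> continuous phi ->
  closed C ->
  hits (argmin F phi) C = hits F setT `&` ~` \bigcup_(r : rat)
    (hits F [set xy | phi xy <= ratr r] `\`
     hits F (C `&` [set xy | phi xy <= ratr r])).
Proof.
move=> cF cphi cC; apply/seteqP; split => x.
  move=> [y [Fy ymin] Cy]; split; first by exists y.
  move=> [r _] [[z Fz /= zr]] []; exists y => //; split => //=.
  by rewrite (le_trans _ zr)// ymin.
move=> [[y0 Fy0 _] H].
have cphix := @continuous_section _ x cphi.
have [z Fz zmin] := compact_min (cF x) cphix (ex_intro _ y0 Fy0).
have cFC : compact (F x `&` [set y | C (x, y)]).
  by apply: compact_closedI => //; exact: closed_section.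
have hit r : phi (x, z) <= ratr r ->
    exists2 y, F x y & C (x, y) /\ phi (x, y) <= ratr r.
  move=> zr; apply: contrapT => nhit; apply: H; exists r => //.
  by split; [exists z|move=> [y Fy Cy]; apply: nhit; exists y].
have [y1 [Fy1 Cy1]] : F x `&` [set y | C (x, y)] !=set0.
  have [r] : exists r : rat, ratr r \in `](phi (x, z)), (phi (x, z) + 1)[.
    by apply: rat_in_itvoo; rewrite ltrDl.
  rewrite in_itv/= => /andP[/ltW/hit[y Fy [Cy _]] _].
  by exists y.
have [y [Fy Cy] ymin] := compact_min cFC cphix (ex_intro _ y1 (conj Fy1 Cy1)).
exists y => //; split => // w Fw; apply: le_trans (zmin w Fw).
rewrite leNgt; apply/negP => zy.
have [r] : exists r : rat, ratr r \in `](phi (x, z)), (phi (x, y))[.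
  exact: rat_in_itvoo.
rewrite in_itv/= => /andP[/ltW/hit[v Fv [Cv vr]] ry].
by have := ymin v (conj Fv Cv); rewrite leNgt (le_lt_trans vr ry).
Qed.

Lemma measurable_compact_valued_argmin F phi : continuous phi ->
  measurable_compact_valued F -> measurable_compact_valued (argmin F phi).
Proof.
move=> cphi [cF mF]; split=> [x|C cC].
  rewrite (_ : argmin F phi x = F x `&`
      \bigcap_(z in F x) [set y | phi (x, y) <= phi (x, z)]) //.
  apply: compact_closedI => //; apply: closed_bigI => z Fz.
  apply: closed_le_fun; first exact: continuous_section.
  by move=> y; exact: cvg_cst.
rewrite hits_argmin//; apply: measurableI; first exact: mF closedT.
apply: measurableC; apply: bigcupT_measurable_rat => r.
apply: measurableD; apply: mF; first exact: closed_le_cst.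
by apply: closedI => //; exact: closed_le_cst.
Qed.

(* Minimising the entries of s one after the other leaves the value of s
   undetermined nowhere, without any injectivity of s in y. *)
Lemma measurable_selection p q (s : X * Y -> 'M[R]_(p, q)) F :
  mx_continuous s -> measurable_compact_valued F ->
  exists2 g : X -> 'M[R]_(p, q), measurable_fun setT g &
    forall x, F x !=set0 -> exists2 y, F x y & g x = s (x, y).
Proof.
move=> cs mF; pose ent ij : X * Y -> R := fun xy => s xy ij.1 ij.2.
(* Induction over the list of entries: each minimisation shrinks the set of choices and fixes the
   value of one more entry, and after the last one the whole matrix is constant on [G x]. *)
have {mF} [G [mG GF G0 Gs]] : exists G, [/\ measurable_compact_valued G,
    forall x, G x `<=` F x, forall x, F x !=set0 -> G x !=set0 &
    forall x y z, G x y -> G x z -> forall ij, ij \in enum {: 'I_p * 'I_q} ->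
      ent ij (x, y) = ent ij (x, z)].
  elim: (enum _) => [|ij r [G [mG GF G0 Gs]]].
    by exists F; split => // x; exact: subset_refl.
  exists (argmin G (ent ij)); split.
  - by apply: measurable_compact_valued_argmin => //; exact: cs.
  - by move=> x y [/GF].
  - by move=> x /G0 Gx0; apply: argmin_nonempty => //; [exact: mG.1|exact: cs].
  - move=> x y z [Gy ymin] [Gz zmin] kl; rewrite in_cons => /predU1P[->|klr].
      by apply/eqP; rewrite eq_le ymin// zmin.
    exact: Gs klr.
pose g x := if pselect (G x !=set0) is left h
  then s (x, projT1 (cid h)) else 0.
have gP x y : G x y -> g x = s (x, y).
  move=> Gy; rewrite /g; case: pselect => [h|[]]; last by exists y.
  case: cid => z /= Gz; apply/matrixP => i j.
  by apply: (Gs x z y Gz Gy (i, j)); rewrite mem_enum.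
exists g; last by move=> x /G0[y Gy]; exists y; [exact: GF Gy|exact: gP].
apply: measurable_fun_mx => i j; apply: measurable_fun_le_sets => t.
have mGT : measurable (hits G setT) by apply: mG.2; exact: closedT.
(* [g] takes the default value [0] where [G x] is empty, which adds a piece exactly when
   [0 <= t]. *)
rewrite (_ : [set x | _] = hits G [set xy | ent (i, j) xy <= t] `|`
    (~` hits G setT `&` [set x | 0 <= t])).
  apply: measurableU; first by apply: mG.2; apply: closed_le_cst; exact: cs.
  apply: measurableI; first exact: measurableC.
  rewrite (_ : mkset _ = if 0 <= t then setT else set0); first by case: ifP.
  by apply/seteqP; split => x /=; case: ifP.
apply/seteqP; split => x /=.
  have [[y Gy]|nG] := pselect (G x !=set0).
    by rewrite (gP _ _ Gy) => st; left; exists y.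
  have -> : g x = 0 by rewrite /g; case: pselect.
  by rewrite mxE => t0; right; split => // -[y Gy _]; apply: nG; exists y.
move=> [[y Gy]|[nG t0]]; first by rewrite (gP _ _ Gy).
have -> : g x = 0.
  by rewrite /g; case: pselect => // -[y Gy]; case: nG; exists y.
by rewrite mxE.
Qed.

End selection.

(** * A measurable EAKF update map *)

Section eakf_selection.
Context (R : realType) (d q K : nat) (H : 'M[R]_(q, d)).

Let c : R := (K%:R - 1)^-1.

Lemma ens_devE (V : 'M[R]_(d, K)) i k :
  ens_dev V i k = V i k - K%:R^-1 * \sum_j V i j.
Proof.
rewrite !mxE summxE; congr (_ - _ * _).
by apply: eq_bigr => j _; rewrite mxE.
Qed.

Section fixed_rank.
Context (p : nat).
Local Notation choice := ('M[R]_(p, d) * 'M[R]_(p, K) * 'M[R]_p)%type.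
Implicit Type xy : 'M[R]_(d, K) * choice.

(* A choice (P, R1, G) stands for the decompositions with Q1 = P^T and G1 = G:
   the diagonal matrices are then determined by the input. *)
Definition svals xy : 'rV[R]_p :=
  \row_i (xy.2.1.1 *m ens_dev xy.1 *m xy.2.1.2^T) i i.

Definition scaled_gram xy : 'M[R]_p :=
  c *: (diag_mx (svals xy) *m xy.2.1.1 *m H^T *m H *m xy.2.1.1^T
          *m diag_mx (svals xy)).

Definition evals xy : 'rV[R]_p :=
  \row_i (xy.2.2 *m scaled_gram xy *m xy.2.2^T) i i.

(* The absolute value is harmless, as the eigenvalues are nonnegative, and makes
   the spread continuous in the choice everywhere. *)
Definition shrink (x : R) : R := (Num.sqrt (1 + `|x|))^-1.

Definition spread xy : 'M[R]_(d, K) :=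
  xy.2.1.1^T *m diag_mx (svals xy) *m xy.2.2^T
    *m diag_mx (map_mx shrink (evals xy)) *m xy.2.1.2.

Definition orthonormal_choices : set choice :=
  ([set P | P *m P^T = 1%:M] `*` [set R1 | R1 *m R1^T = 1%:M]) `*`
  [set G | G *m G^T = 1%:M].

(** Non-strict signs keep the condition closed; [spread_eakf] recovers strict positivity of the
    singular values when [p] is the rank. *)
Definition nonneg_descending (l : 'rV[R]_p) :=
  forall i j : 'I_p, 0 <= l 0 i /\ ((i <= j)%N -> l 0 j <= l 0 i).

Definition decomposes : set ('M[R]_(d, K) * choice) :=
  [set xy | nonneg_descending (svals xy)] `&`
  [set xy | ens_dev xy.1 = xy.2.1.1^T *m diag_mx (svals xy) *m xy.2.1.2] `&`
  [set xy | nonneg_descending (evals xy)] `&`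
  [set xy | xy.2.2^T *m diag_mx (evals xy) *m xy.2.2 = scaled_gram xy].

Definition choices (V : 'M[R]_(d, K)) : set choice :=
  [set y | orthonormal_choices y /\ decomposes (V, y)].

Lemma compact_orthonormal_choices : compact orthonormal_choices.
Proof.
by apply: compact_setX; [apply: compact_setX|]; exact: compact_orthonormal_rows.
Qed.

Let T := ('M[R]_(d, K) * choice)%type.

Lemma continuous_row_diag (f : T -> 'M[R]_p) :
  mx_continuous f -> mx_continuous (fun x => \row_i f x i i : 'rV_p).
Proof.
move=> cf i j; rewrite (_ : (fun x => _) = (fun x => f x j j)); first exact: cf.
by apply/funext => x; rewrite mxE.
Qed.

Lemma closed_nonneg_descending (f : T -> 'rV[R]_p) : mx_continuous f ->
  closed [set x | nonneg_descending (f x)].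
Proof.
(* The conditional index turns the implication into an inequality that is trivial when
   [ij.2 < ij.1], so that each member of the intersection is closed. *)
move=> cf; rewrite (_ : mkset _ = \bigcap_(ij in [set: 'I_p * 'I_p])
    ([set x | 0 <= f x 0 ij.1] `&`
     [set x | f x 0 (if (ij.1 <= ij.2)%N then ij.2 else ij.1) <= f x 0 ij.1])).
  apply: closed_bigI => -[i j] _; apply: closedI; apply: closed_le_fun => //.
  by move=> x; exact: cvg_cst.
apply/seteqP; split => x /= h.
  move=> [i j] _ /=; have [h0 hij] := h i j; split => //=.
  by case: ifP => // /hij.
by move=> i j; have [/= h0 hij] := h (i, j) I; split => // ij; move: hij; rewrite ij.
Qed.

Let cV : mx_continuous (fun xy : T => xy.1).
Proof. by apply: continuous_mx => xy; exact: cvg_fst. Qed.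

Let cP : mx_continuous (fun xy : T => xy.2.1.1).
Proof.
apply: continuous_mx => xy.
by apply: (@cvg_comp _ _ _ snd (fun y : choice => y.1.1)); [exact: cvg_snd|
  apply: (@cvg_comp _ _ _ fst fst); exact: cvg_fst].
Qed.

Let cR : mx_continuous (fun xy : T => xy.2.1.2).
Proof.
apply: continuous_mx => xy.
by apply: (@cvg_comp _ _ _ snd (fun y : choice => y.1.2)); [exact: cvg_snd|
  apply: (@cvg_comp _ _ _ fst snd); [exact: cvg_fst|exact: cvg_snd]].
Qed.

Let cG : mx_continuous (fun xy : T => xy.2.2).
Proof.
apply: continuous_mx => xy.
by apply: (@cvg_comp _ _ _ snd (fun y : choice => y.2)); exact: cvg_snd.
Qed.

Let cdev : mx_continuous (fun xy : T => ens_dev xy.1).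
Proof.
move=> i k; under eq_fun do rewrite ens_devE.
move=> x; apply: cvgB; first exact: cV.
apply: cvgM; first exact: cvg_cst.
by apply: continuous_sum => j; exact: cV.
Qed.

Lemma continuous_svals : mx_continuous svals.
Proof.
apply: continuous_row_diag; apply: mx_continuousM; last exact: mx_continuousT.
exact: mx_continuousM.
Qed.

Lemma continuous_scaled_gram : mx_continuous scaled_gram.
Proof.
have cl := mx_continuous_diag continuous_svals.
apply: mx_continuousZ; apply: mx_continuousM => //.
apply: mx_continuousM; last exact: mx_continuousT.
apply: mx_continuousM; last exact: mx_continuous_cst.
apply: mx_continuousM; last exact: mx_continuous_cst.
exact: mx_continuousM.
Qed.

Lemma continuous_evals : mx_continuous evals.
Proof.
apply: continuous_row_diag; apply: mx_continuousM; last exact: mx_continuousT.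
by apply: mx_continuousM => //; exact: continuous_scaled_gram.
Qed.

Lemma continuous_shrink : continuous shrink.
Proof.
move=> x; apply: cvgV.
  by rewrite gt_eqF// sqrtr_gt0 ltr_wpDr.
apply: continuous_comp; last exact: sqrt_continuous.
by apply: cvgD; [exact: cvg_cst|exact: norm_continuous].
Qed.

Lemma continuous_spread : mx_continuous spread.
Proof.
apply: mx_continuousM => //; apply: mx_continuousM.
  apply: mx_continuousM; last exact: mx_continuousT.
  apply: mx_continuousM; first exact: mx_continuousT.
  exact: mx_continuous_diag continuous_svals.
apply: mx_continuous_diag => i j; under eq_fun do rewrite mxE.
move=> x; apply: (@continuous_comp _ _ _ (fun xy => evals xy i j) shrink).
  exact: continuous_evals.
exact: continuous_shrink.
Qed.

Lemma closed_decomposes : closed decomposes.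
Proof.
have cl := mx_continuous_diag continuous_svals.
have ce := mx_continuous_diag continuous_evals.
apply: closedI; first apply: closedI; first apply: closedI.
- exact/closed_nonneg_descending/continuous_svals.
- apply: closed_eq_mx => //; apply: mx_continuousM => //.
  by apply: mx_continuousM => //; exact: mx_continuousT.
- exact/closed_nonneg_descending/continuous_evals.
- apply: closed_eq_mx; last exact: continuous_scaled_gram.
  by apply: mx_continuousM => //; apply: mx_continuousM => //;
    exact: mx_continuousT.
Qed.

Lemma measurable_choices : measurable_compact_valued choices.
Proof.
exact: measurable_compact_valued_closed compact_orthonormal_choices
  closed_decomposes.
Qed.

Lemma choices_rank V : choices V !=set0 -> (\rank (ens_dev V) <= p)%N.
Proof.
move=> [y [_ [[[_ /= -> _] _]]]].
exact: leq_trans (mulmx_max_rank _ _) _.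
Qed.

End fixed_rank.

Lemma reduced_svd_svals p (V : 'M[R]_(d, K)) (P : 'M[R]_(p, d)) R1 (G : 'M[R]_p)
    (l : 'rV[R]_p) : P *m P^T = 1%:M -> R1 *m R1^T = 1%:M ->
  ens_dev V = P^T *m diag_mx l *m R1 -> svals (V, (P, R1, G)) = l.
Proof.
move=> PP RR VE; apply/rowP => i; rewrite mxE /= VE.
rewrite -!mulmxA RR mulmx1 mulmxA PP mul1mx.
by rewrite mxE eqxx mulr1n.
Qed.

Lemma choices_nonempty V : (1 <= K)%N ->
  @choices (\rank (ens_dev V)) V !=set0.
Proof.
move=> K1; have [Q1 [l [R1 [QQ RR l0 De VE]]]] := reduced_svd_exists (ens_dev V).
have c0 : 0 <= c by rewrite invr_ge0 subr_ge0 ler1n.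
have [G [D [GG D0 DeD GDG]]] :=
  @psd_eigen_decomposition R _ _ (diag_mx l *m Q1^T *m H^T) c c0.
have lE : svals (V, (Q1^T, R1, G)) = l.
  by apply: reduced_svd_svals => //; rewrite trmxK.
have GG' : G *m G^T = 1%:M by exact: mulmx1C.
have AE : scaled_gram (V, (Q1^T, R1, G)) = G^T *m diag_mx D *m G.
  by rewrite GDG /scaled_gram lE /= !trmx_mul !trmxK tr_diag_mx !mulmxA.
have DE : evals (V, (Q1^T, R1, G)) = D.
  apply/rowP => i; rewrite mxE AE /= !mulmxA GG' mul1mx -mulmxA GG' mulmx1.
  by rewrite mxE eqxx mulr1n.
exists (Q1^T, R1, G); split; first by split => //=; rewrite trmxK.
split; last by rewrite /= DE AE.
split; last by rewrite /= DE => i j; split => // /DeD.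
split; last by rewrite /= lE trmxK.
by rewrite /= lE => i j; split; [exact: ltW|move/De].
Qed.

Lemma spread_eakf V y : @choices (\rank (ens_dev V)) V y ->
  eakf_spread H V (spread (V, y)).
Proof.
case: y => [[P R1] G] [[[/= PP RR] GG] [[[/= l0 VE] D0] GDG]].
have GG' : G^T *m G = 1%:M by exact: mulmx1C.
have l_gt0 i : 0 < svals (V, (P, R1, G)) 0 i.
  rewrite lt_def (l0 i i).1 andbT.
  (* The deviations have rank [p] and factor through this diagonal matrix of size [p], which
     therefore has full rank and no zero entry. *)
  have : diag_mx (svals (V, (P, R1, G))) \in unitmx.
    rewrite -row_free_unit -row_leq_rank.
    rewrite {1}VE (leq_trans (mxrankM_maxl _ _))//.
    exact: mxrankM_maxr.
  by rewrite unitmxE det_diag unitfE prodf_seq_neq0 => /allP/(_ i); apply;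
    exact: mem_index_enum.
exists P^T, (svals (V, (P, R1, G))), R1, G, (evals (V, (P, R1, G))); split.
- by split => //; [rewrite trmxK|move=> i j /(l0 i j).2].
- split => // [i|i j /(D0 i j).2//|]; first exact: (D0 i i).1.
  by rewrite GDG /scaled_gram trmxK.
- rewrite /spread /=; congr (_ *m diag_mx _ *m _); apply/rowP => i.
  by rewrite [LHS]mxE [RHS]mxE /shrink ger0_norm// (D0 i i).1.
Qed.

(** The rank is the least [p] that admits a choice: a choice of size [p] forces rank at most [p],
    and one whose size is the rank exists. Its level sets are therefore differences of hit sets. *)
Lemma measurable_rank_ens_dev p : (1 <= K)%N ->
  measurable [set V : 'M[R]_(d, K) | \rank (ens_dev V) = p].
Proof.
move=> K1; pose D r := hits (@choices r) setT.
have mD r : measurable (D r) by apply: (measurable_choices r).2; exact: closedT.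
rewrite (_ : mkset _ = D p `\` \bigcup_(r in `I_p) D r); last first.
  apply/seteqP; split => V /=.
    move=> <-; split; first by have [y Vy] := choices_nonempty V K1; exists y.
    move=> [r /= rp [y Vy _]]; have := choices_rank (ex_intro _ y Vy).
    by rewrite leqNgt rp.
  move=> [[y Vy _] nD]; apply/eqP; rewrite eqn_leq.
  rewrite (choices_rank (ex_intro _ y Vy)) leqNgt.
  apply/negP => Vp; apply: nD; exists (\rank (ens_dev V)) => //.
  by have [z Vz] := choices_nonempty V K1; exists z.
by apply: measurableD => //; exact: bigcup_measurable.
Qed.

Lemma measurable_eakf_spread : (1 <= K)%N ->
  exists2 S : 'M[R]_(d, K) -> 'M[R]_(d, K), measurable_fun setT S &
    forall V, eakf_spread H V (S V).
Proof.
move=> K1.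
have sel p : exists g, measurable_fun setT g /\ forall V : 'M[R]_(d, K),
    @choices p V !=set0 -> exists2 y, @choices p V y & g V = spread (V, y).
  have [g mg gP] := measurable_selection (@continuous_spread p)
    (measurable_choices p).
  by exists g.
have [g gP] := boolp.choice sel.
exists (fun V => g (\rank (ens_dev V)) V).
  move=> _ A mA; rewrite setTI (_ : _ @^-1` A =
      \bigcup_p ([set V | \rank (ens_dev V) = p] `&` g p @^-1` A)).
    apply: bigcupT_measurable => p; apply: measurableI.
      exact: measurable_rank_ens_dev.
    by rewrite -[X in measurable X]setTI; apply: (gP p).1.
  by apply/seteqP; split => [V AV|V [p _ [<-]]//]; exists (\rank (ens_dev V)).
move=> V; have [y Vy ->] := (gP _).2 V (choices_nonempty V K1).
exact: spread_eakf.
Qed.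

Lemma measurable_ens_mean : measurable_fun setT (@ens_mean R d K).
Proof.
apply: measurable_fun_mx => i j.
rewrite (_ : (fun V => _) = (fun V : 'M[R]_(d, K) => K%:R^-1 * \sum_k V i k)).
  apply: measurable_funM; first exact: measurable_cst.
  by apply: measurable_sum => k; exact: measurable_mx_entry.
apply/funext => V; rewrite mxE summxE; congr (_ * _).
by apply: eq_bigr => k _; rewrite mxE.
Qed.

Lemma measurable_ens_cov : measurable_fun setT (@ens_cov R d K).
Proof.
have mdev : measurable_fun setT (@ens_dev R d K).
  apply: measurable_fun_mx => i k; under eq_fun do rewrite ens_devE.
  apply: measurable_funB; first exact: measurable_mx_entry.
  apply: measurable_funM; first exact: measurable_cst.
  by apply: measurable_sum => j; exact: measurable_mx_entry.
apply: measurable_fun_scalemx; apply: measurable_fun_mulmx => //.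
exact: measurable_fun_trmx.
Qed.

Lemma measurable_eakf_mean :
  measurable_fun setT (fun Vz : 'M[R]_(d, K) * 'cV[R]_q => eakf_mean H Vz.1 Vz.2).
Proof.
have mcst m n (A : 'M[R]_(m, n)) :
    measurable_fun setT (fun _ : 'M[R]_(d, K) * 'cV[R]_q => A).
  exact: measurable_cst.
have mm := measurableT_comp measurable_ens_mean
  (@measurable_fst _ _ 'M[R]_(d, K) 'cV[R]_q).
have mC := measurableT_comp measurable_ens_cov
  (@measurable_fst _ _ 'M[R]_(d, K) 'cV[R]_q).
have mz := @measurable_snd _ _ 'M[R]_(d, K) 'cV[R]_q.
apply: measurable_fun_addmx => //; apply: measurable_fun_oppmx.
apply: measurable_fun_mulmx; last first.
  apply: measurable_fun_addmx; last exact: measurable_fun_oppmx.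
  exact: measurable_fun_mulmx.
apply: measurable_fun_mulmx; first exact: measurable_fun_mulmx.
apply: measurable_fun_invmx; apply: measurable_fun_addmx => //.
apply: measurable_fun_mulmx => //; exact: measurable_fun_mulmx.
Qed.

Lemma eakf_update_map_exists : (1 <= K)%N ->
  exists Gamma, @eakf_update_map R d q K H Gamma.
Proof.
move=> /measurable_eakf_spread[S mS SP].
exists (fun x => (x.1.1, \matrix_(i, k)
  (eakf_mean H x.1.2 x.2 i 0 + S x.1.2 i k))); split; last first.
  by move=> u V z; exists (S V).
apply/measurable_fun_pair => /=.
  exact: measurableT_comp measurable_fst measurable_fst.
have mV : measurable_fun setT
    (fun x : 'cV[R]_d * 'M[R]_(d, K) * 'cV[R]_q => x.1.2).
  exact: measurableT_comp measurable_snd measurable_fst.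
apply: measurable_fun_mx => i k; under eq_fun do rewrite mxE.
apply: measurable_funD; last first.
  exact: measurable_fun_mx_entry (measurableT_comp mS mV).
apply: measurable_fun_mx_entry.
have mVz : measurable_fun setT
    (fun x : 'cV[R]_d * 'M[R]_(d, K) * 'cV[R]_q => (x.1.2, x.2)).
  by apply/measurable_fun_pair => //; exact: measurable_snd.
exact: (measurableT_comp measurable_eakf_mean mVz).
Qed.

End eakf_selection.

(** * Mean functionals and Markov operators *)

Section bounded_measurable.
Context d (T : measurableType d) (R : realType).
Implicit Types (f g : T -> R) (mu : probability T R).

Definition bmeas f :=
  measurable_fun setT f /\ exists M : R, forall x, `|f x| <= M.

Lemma bmeas_integrable mu f : bmeas f -> mu.-integrable setT (EFin \o f).
Proof.
move=> [mf [M fM]]; apply: measurable_bounded_integrable => //.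
  by rewrite (le_lt_trans (probability_le1 mu measurableT))// ltry.
exists M; split; first exact: num_real.
by move=> z Mz x _; apply: le_trans (fM x) (ltW Mz).
Qed.

Lemma bmeas_cst (r : R) : bmeas (fun=> r).
Proof. by split; [exact: measurable_cst|exists `|r|]. Qed.

Lemma bmeasD f g : bmeas f -> bmeas g -> bmeas (fun x => f x + g x).
Proof.
move=> [mf [M fM]] [mg [N gN]]; split; first exact: measurable_funD.
by exists (M + N) => x; rewrite (le_trans (ler_normD _ _))// lerD.
Qed.

Lemma bmeasZ (r : R) f : bmeas f -> bmeas (fun x => r * f x).
Proof.
move=> [mf [M fM]]; split.
  by apply: measurable_funM => //; exact: measurable_cst.
by exists (`|r| * M) => x; rewrite normrM ler_wpM2l.
Qed.

Lemma bmeas_sum I (s : seq I) (F : I -> T -> R) : (forall i, bmeas (F i)) ->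
  bmeas (fun x => \sum_(i <- s) F i x).
Proof.
move=> bF; elim: s => [|i s IHs].
  by under eq_fun do rewrite big_nil; exact: bmeas_cst.
by under eq_fun do rewrite big_cons; exact: bmeasD.
Qed.

Lemma bmeas_indic A : measurable A -> bmeas \1_A.
Proof.
move=> mA; split; first exact: measurable_indic.
by exists 1 => x; rewrite indicE; case: (_ \in _); rewrite ?normr1 ?normr0.
Qed.

(** Countable additivity is left out on purpose: the limit of the iterates of the chain must be
    handled before it is known to be an integral. *)
Definition mean_functional (L : (T -> R) -> R) :=
  [/\ forall f g, bmeas f -> bmeas g -> L (fun x => f x + g x) = L f + L g,
      forall r f, bmeas f -> L (fun x => r * f x) = r * L f,
      forall f g, bmeas f -> bmeas g -> (forall x, f x <= g x) -> L f <= L g &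
      L (fun=> 1) = 1].

Lemma mean_functional_Rintegral mu : mean_functional (fun f => \int[mu]_x f x).
Proof.
split => [f g bf bg|r f bf|f g bf bg fg|].
- by rewrite RintegralD//; exact: bmeas_integrable.
- by rewrite RintegralZl//; exact: bmeas_integrable.
- by apply: le_Rintegral => //; exact: bmeas_integrable.
- rewrite Rintegral_cst// mul1r; exact: (congr1 fine (probability_setT mu)).
Qed.

Section mean_functional_theory.
Context (L : (T -> R) -> R) (mL : mean_functional L).

Lemma mean_functional_cst r : L (fun=> r) = r.
Proof.
have [_ LZ _ L1] := mL; have := LZ r _ (bmeas_cst 1).
by rewrite /= L1 mulr1.
Qed.

Lemma mean_functional_bound f M : bmeas f -> (forall x, `|f x| <= M) ->
  `|L f| <= M.
Proof.
move=> bf fM; have [_ _ Lle _] := mL; have LM := mean_functional_cst.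
have fM' x : - M <= f x <= M by rewrite -ler_norml.
rewrite ler_norml; apply/andP; split; [rewrite -[leLHS]LM|rewrite -[leRHS]LM];
  by apply: Lle => //; [exact: bmeas_cst|move=> x; have /andP[] := fM' x].
Qed.

Lemma mean_functionalB f g : bmeas f -> bmeas g ->
  L (fun x => f x - g x) = L f - L g.
Proof.
move=> bf bg; have [LD LZ _ _] := mL.
rewrite -mulN1r -LZ// -LD//; last exact: bmeasZ.
by congr L; apply/funext => x; rewrite mulN1r.
Qed.

Lemma mean_functional_sum I (s : seq I) (F : I -> T -> R) :
  (forall i, bmeas (F i)) ->
  L (fun x => \sum_(i <- s) F i x) = \sum_(i <- s) L (F i).
Proof.
move=> bF; elim: s => [|i s IHs].
  under eq_fun do rewrite big_nil.
  by rewrite big_nil mean_functional_cst.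
under eq_fun do rewrite big_cons.
have [LD _ _ _] := mL; rewrite LD//; last exact: bmeas_sum.
by rewrite IHs big_cons.
Qed.

End mean_functional_theory.

(** [S] counts the integers from [1] to [N] that are at most [y], hence is the minimum of [N] and
    the integer part of [y]. *)
Lemma layers_count N (y : R) : 0 <= y ->
  let S : R := \sum_(k < N) (nat_of_bool (k.+1%:R <= y))%:R in
  if N%:R <= y then S = N%:R else S <= y < S + 1.
Proof.
move=> y0 /=; elim: N => [|N]; first by rewrite y0 big_ord0.
rewrite big_ord_recr /=; case: (leP N%:R y) => Ny; case: (leP N.+1%:R y) => SNy.
- by move=> ->; rewrite natr1.
- by move=> ->; rewrite addr0 Ny natr1.
- by move: Ny; rewrite ltNge (le_trans _ SNy)// ler_nat.
- by rewrite addr0.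
Qed.

(** Rounds [f] down to a multiple of [1 / N] when [0 <= f <= 1]. Being a finite sum of indicators,
    its image under a mean functional is determined by the values on sets. *)
Definition layers N f : T -> R :=
  fun x => N%:R^-1 * \sum_(k < N) \1_[set z | k.+1%:R <= N%:R * f z] x.

Lemma layers_approx N f x : (0 < N)%N -> 0 <= f x <= 1 ->
  `|f x - layers N f x| <= N%:R^-1.
Proof.
move=> N0 /andP[f0 f1]; have NR : 0 < N%:R :> R by rewrite ltr0n.
have Nf0 : 0 <= N%:R * f x by rewrite mulr_ge0// ltW.
have E k : \1_[set z | k.+1%:R <= N%:R * f z] x =
    (nat_of_bool (k.+1%:R <= N%:R * f x))%:R :> R.
  by rewrite indicE; congr (_%:R); congr nat_of_bool; apply/idP/idP;
    rewrite inE.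
rewrite /layers; under eq_bigr do rewrite E.
rewrite -[X in `|X - _|](mulKf (lt0r_neq0 NR)) -mulrBr normrM.
have NI : 0 <= N%:R^-1 :> R by rewrite invr_ge0 ltW.
rewrite (ger0_norm NI) ler_piMr//.
have /= := layers_count N Nf0; case: ifP => [Ny ->|_ /andP[le1 lt2]].
  have -> : N%:R * f x = N%:R.
    by apply/eqP; rewrite eq_le Ny andbT ler_piMr// ltW.
  by rewrite subrr normr0.
by rewrite ger0_norm ?subr_ge0// lerBlDl addrC ltW// addrC.
Qed.

Lemma measurable_layer (t : R) f : measurable_fun setT f ->
  measurable [set z | t <= f z].
Proof.
move=> mf; rewrite -[X in measurable X]setTI.
rewrite (_ : mkset _ = f @^-1` `[t, +oo[); first exact: mf.
by apply/seteqP; split => x /=; rewrite in_itv/= andbT.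
Qed.

(* Approximating by layers, since no integral representation of L is known. *)
Lemma mean_functional_unique (L1 L2 : (T -> R) -> R) f :
  mean_functional L1 -> mean_functional L2 ->
  (forall A, measurable A -> L1 \1_A = L2 \1_A) ->
  measurable_fun setT f -> (forall x, 0 <= f x <= 1) -> L1 f = L2 f.
Proof.
move=> mL1 mL2 L12 mf f01.
have bf : bmeas f.
  by split => //; exists 1 => x; have /andP[f0 f1] := f01 x; rewrite ger0_norm.
have mA N (k : 'I_N) : measurable [set z | k.+1%:R <= N%:R * f z].
  by apply: measurable_layer; apply: measurable_funM => //; exact: measurable_cst.
have bl N : bmeas (layers N f).
  by apply/bmeasZ/bmeas_sum => k; exact/bmeas_indic/mA.
have Ll N : L1 (layers N f) = L2 (layers N f).
  rewrite /layers; have bA k := bmeas_indic (mA N k).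
  case: (mL1) (mL2) => [_ Z1 _ _] [_ Z2 _ _].
  rewrite Z1 ?Z2; [|exact: bmeas_sum..].
  rewrite !mean_functional_sum//; congr (_ * _).
  by apply: eq_bigr => k _; exact: L12.
have close L N : mean_functional L -> (0 < N)%N ->
    `|L f - L (layers N f)| <= N%:R^-1.
  move=> mL N0; rewrite -mean_functionalB//.
  apply: mean_functional_bound => // [|x]; last exact: layers_approx.
  have bN := bmeasZ (-1) (bl N).
  by have := bmeasD bf bN; under eq_fun do rewrite mulN1r.
apply/eqP; rewrite -subr_eq0 -normr_le0 leNgt; apply/negP => e0.
(* Each functional moves by at most [1 / N] when [f] is replaced by its layers, so [2 / N] below the
   supposed gap is a contradiction. *)
have [N N0 Ne] : exists2 N, (0 < N)%N & 2 * N%:R^-1 < `|L1 f - L2 f|.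
  have h0 : 0 < `|L1 f - L2 f| / 2 by rewrite divr_gt0.
  exists (Num.truncn (`|L1 f - L2 f| / 2)^-1).+1 => //.
  rewrite mulrC -ltr_pdivlMr// invf_plt ?posrE//.
  exact: Num.Theory.truncnS_gt.
have := close _ N mL1 N0; have := close _ N mL2 N0.
rewrite -Ll => c2 c1; move: Ne; apply/negP; rewrite -leNgt.
rewrite mulr2n mulrDl !mul1r.
rewrite -[X in `|X|](subrKA (L1 (layers N f))).
by rewrite (le_trans (ler_normD _ _))// lerD// distrC.
Qed.

End bounded_measurable.

Section geometric_cauchy.
Context (R : realType).

(** The steps from time [n] on sum to at most [D * r ^+ n]. Adding this tail to [u] gives a
    nonincreasing sequence, subtracting it a nondecreasing one, and the two enclose the limit. *)
Lemma cvg_geometric_steps (u : nat -> R) (C r : R) : 0 <= C -> 0 < r < 1 ->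
  (forall n, `|u n.+1 - u n| <= C * r ^+ n) ->
  exists l, u n @[n --> \oo] --> l /\
    forall n, `|u n - l| <= C / (1 - r) * r ^+ n.
Proof.
move=> C0 /andP[r0 r1] uC; set D := C / (1 - r).
have r1' : 0 < 1 - r by rewrite subr_gt0.
have D0 : 0 <= D by rewrite divr_ge0// ltW.
have DC : C = D * (1 - r) by rewrite /D divfK// gt_eqF.
pose v n := u n + D * r ^+ n; pose w n := u n - D * r ^+ n.
have step n : `|u n.+1 - u n| <= D * r ^+ n - D * r ^+ n.+1.
  by rewrite exprS (le_trans (uC n))// DC le_eqVlt; apply/predU1P; left; ring.
have vdec : nonincreasing_seq v.
  apply/nonincreasing_seqP => n; have := step n.
  by rewrite /v ler_norml => /andP[_]; lra.
have winc : nondecreasing_seq w.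
  apply/nondecreasing_seqP => n; have := step n.
  by rewrite /w ler_norml => /andP[+ _]; lra.
have Dr n : 0 <= D * r ^+ n by rewrite mulr_ge0// exprn_ge0// ltW.
have wv n : w n <= v n by have := Dr n; rewrite /w /v; lra.
have cv : cvgn v.
  apply: nonincreasing_is_cvgn => //; exists (w 0%N) => _ [n _ <-].
  by rewrite (le_trans (winc 0%N n _)).
have cDr : D * r ^+ n @[n --> \oo] --> 0.
  rewrite -(mulr0 D); apply: cvgM; first exact: cvg_cst.
  by apply: cvg_expr; rewrite ger0_norm// ltW.
have cu : u n @[n --> \oo] --> limn v.
  rewrite -[limn v]subr0 (_ : (fun n => u n) = (fun n => v n - D * r ^+ n)).
    exact: cvgB.
  by apply/funext => n; rewrite /v addrK.
have cw : w n @[n --> \oo] --> limn v.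
  by rewrite -[limn v]subr0; exact: cvgB.
exists (limn v); split => // n; rewrite ler_distl.
apply/andP; split.
  have := nonincreasing_cvgn_ge vdec cv n; rewrite /v.
  by lra.
have wn : w n <= limn v.
  rewrite -(cvg_lim (@Rhausdorff R) cw).
  by apply: nondecreasing_cvgn_le => //; apply/cvg_ex; exists (limn v).
by move: wn; rewrite /w; lra.
Qed.

End geometric_cauchy.

Section markov_operator.
Context d (T : measurableType d) (R : realType) (P : T -> probability T R).
Hypothesis mP : forall A, measurable A -> measurable_fun setT (fun x => P x A).
Implicit Types f g : T -> R.

Definition markov_op f : T -> R := fun x => \int[P x]_y f y.

Lemma measurable_markov_op f : bmeas f -> measurable_fun setT (markov_op f).
Proof.
move=> bf; have [mf [M fM]] := bf.
(* Adding [M] makes the integrand nonnegative, as [measurable_fun_integral_kernel] requires. *)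
have M0 x : 0 <= f x + M by have := fM x; rewrite ler_norml; lra.
have bfM := bmeasD bf (bmeas_cst _ M).
have E x : markov_op f x = fine (\int[P x]_y (f y + M)%:E) - M.
  rewrite -[fine _]/(\int[P x]_y (f y + M))/= RintegralD//; last 2 first.
  - exact: bmeas_integrable.
  - exact/bmeas_integrable/bmeas_cst.
  by rewrite (mean_functional_cst (mean_functional_Rintegral (P x))) addrK.
rewrite (_ : markov_op f = (fun x => fine (\int[P x]_y (f y + M)%:E) - M)).
  apply: measurable_funB; last exact: measurable_cst.
  apply: measurableT_comp => //.
  have [mfM _] := bfM; have {mfM} /measurable_EFinP mfM := mfM.
  apply: (@measurable_fun_integral_kernel _ _ T T R (fun x => P x) mP _ _ mfM).
  by move=> z; rewrite /= lee_fin.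
by apply/funext => x; rewrite E.
Qed.

Lemma bmeas_markov_op f : bmeas f -> bmeas (markov_op f).
Proof.
move=> bf; split; first exact: measurable_markov_op.
have [_ [M fM]] := bf; exists M => x.
exact: (mean_functional_bound (mean_functional_Rintegral (P x))).
Qed.

Lemma markov_op_indic A x : measurable A -> (markov_op \1_A x)%:E = P x A.
Proof.
move=> mA; rewrite /markov_op /Rintegral fineK ?integral_indic ?setIT//.
by rewrite fin_num_measure.
Qed.

Lemma mean_functional_markov_op (L : (T -> R) -> R) :
  mean_functional L -> mean_functional (fun f => L (markov_op f)).
Proof.
move=> [LD LZ Lle L1]; have mI x := mean_functional_Rintegral (P x).
split => [f g bf bg|r f bf|f g bf bg fg|].
- rewrite -LD; [|exact: bmeas_markov_op..]; congr L; apply/funext => x.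
  by rewrite /markov_op; have [->] := mI x.
- rewrite -LZ; last exact: bmeas_markov_op.
  by congr L; apply/funext => x; rewrite /markov_op; have [_ ->] := mI x.
- apply: Lle => [||x]; [exact: bmeas_markov_op..|].
  by rewrite /markov_op; have [_ _ ->] := mI x.
- rewrite -L1; congr L; apply/funext => x.
  by rewrite /markov_op mean_functional_cst.
Qed.

Definition markov_iter n f : T -> R := iter n markov_op f.

Lemma bmeas_markov_iter n f : bmeas f -> bmeas (markov_iter n f).
Proof. by elim: n => [//|n IHn] bf; apply/bmeas_markov_op/IHn. Qed.

Lemma mean_functional_markov_iter n x :
  mean_functional (fun f => markov_iter n f x).
Proof.
(* Each step replaces [L] by its composition with [markov_op], so the induction runs over all
   functionals and not only over evaluation at [x]. *)
suff H (L : (T -> R) -> R) : mean_functional L ->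
    mean_functional (fun f => L (markov_iter n f)).
  by apply: (H (fun f => f x)); split.
elim: n L => [//|n IHn] L mL.
by have := IHn _ (mean_functional_markov_op mL).
Qed.

(** The conclusion of bounded convergence as a property of functionals; it turns the finite
    additivity of a mean functional into countable additivity. *)
Definition pointwise_continuous (L : (T -> R) -> R) :=
  forall (f_ : nat -> T -> R) f (M : R), (forall n, bmeas (f_ n)) ->
    (forall n x, `|f_ n x| <= M) -> bmeas f ->
    (forall x, f_ n x @[n --> \oo] --> f x) ->
    L (f_ n) @[n --> \oo] --> L f.

Lemma Rintegral_pointwise_continuous (mu : probability T R) :
  pointwise_continuous (fun f => \int[mu]_x f x).
Proof.
move=> f_ f M bf_ fM bf cf.
have [|||||_ _] := @dominated_convergence _ _ _ mu setT measurableT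
  (fun n x => (f_ n x)%:E) (fun x => (f x)%:E) (fun=> M%:E).
- by move=> n; apply/measurable_EFinP; case: (bf_ n).
- by apply/measurable_EFinP; case: bf.
- by apply: aeW => x _; apply: cvg_EFin; [exact: nearW|exact: cf].
- exact/bmeas_integrable/bmeas_cst.
- by apply: aeW => x n _; rewrite lee_fin.
have If := integrable_fin_num measurableT (bmeas_integrable mu bf).
by move=> h; apply: fine_cvg; rewrite fineK.
Qed.

Lemma markov_iter_pointwise_continuous n x :
  pointwise_continuous (fun f => markov_iter n f x).
Proof.
move=> f_ f M bf_ fM bf cf; elim: n x => [|n IHn] x; first exact: cf.
apply: (@Rintegral_pointwise_continuous (P x) _ _ M) => //.
- by move=> k; exact: bmeas_markov_iter.
- by move=> k y; apply: (mean_functional_bound (mean_functional_markov_iter n y)).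
- exact: bmeas_markov_iter.
Qed.

End markov_operator.

(** * Harris' theorem *)

Section functional_measure.
Context d (T : measurableType d) (R : realType) (L : (T -> R) -> R).
Hypotheses (mL : mean_functional L) (cL : pointwise_continuous L).
Local Open Scope ereal_scope.

(** A measure must be nonnegative on all sets, while [L] is controlled only on bounded measurable
    functions; hence the truncation at [0], which changes nothing on measurable sets. *)
Definition functional_measure (A : set T) : \bar R := (Num.max 0 (L \1_A))%:E.

Lemma functional_measureE A : measurable A -> functional_measure A = (L \1_A)%:E.
Proof.
move=> mA; rewrite /functional_measure; congr EFin; apply/max_r.
have [_ _ Lle _] := mL; rewrite -(mean_functional_cst mL 0%R).
apply: Lle; [exact: bmeas_cst|exact: bmeas_indic|].
by move=> x; rewrite indicE.
Qed.

Let measure0 : functional_measure set0 = 0.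
Proof.
by rewrite functional_measureE// indic0 (mean_functional_cst mL 0%R).
Qed.

Let measure_ge0 A : 0 <= functional_measure A.
Proof. by rewrite lee_fin le_max lexx. Qed.

Let measure_sigma_additive : semi_sigma_additive functional_measure.
Proof.
move=> F mF tF mUF; rewrite functional_measureE//.
pose S n : T -> R := fun x => (\sum_(i < n) \1_(F i) x)%R.
have bS n : bmeas (S n).
  by apply: bmeas_sum => i; exact: bmeas_indic.
rewrite (_ : (fun n => _) = (fun n => (L (S n))%:E)); last first.
  apply/funext => n; rewrite /S mean_functional_sum//; last first.
    by move=> i; exact: bmeas_indic.
  rewrite -sumEFin big_mkord; apply: eq_bigr => i _.
  by rewrite functional_measureE.
(* By disjointness at most one term is nonzero at [x], so the partial sums are eventually constant
   there and stay in [[0, 1]]. *)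
have Slim x : \forall n \near \oo, S n x = \1_(\bigcup_k F k) x.
  rewrite indicE; case: (boolP (x \in _)) => [|nUx].
    rewrite inE => -[k _ Fx]; near=> n.
    have kn : (k < n)%N by near: n; exact: nbhs_infty_gt.
    rewrite /S (bigD1 (Ordinal kn))//= indicE mem_set// big1 ?addr0// => i ik.
    rewrite indicE memNset// => Fix; move: ik; rewrite -val_eqE/= => /eqP; apply.
    by apply: tF => //; exists x.
  apply: nearW => n; rewrite /S big1// => i _; rewrite indicE memNset// => Fx.
  by move/negP: nUx; apply; rewrite inE; exists i.
have S1 n x : (`|S n x| <= 1)%R.
  rewrite ger0_norm; last by apply: sumr_ge0 => i _; rewrite indicE.
  have [[i Fx]|nF] := pselect (exists i : 'I_n, F i x).
    rewrite /S (bigD1 i)//= big1 ?addr0 => [|j ji].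
      by rewrite indicE; case: (_ \in _).
    rewrite indicE memNset// => Fj; move: ji => /eqP; apply; apply/val_inj => /=.
    by apply: tF => //; exists x.
  rewrite /S big1// => i _; rewrite indicE memNset// => Fx; apply: nF.
  by exists i.
apply: cvg_EFin; first exact: nearW.
apply: (@cL S _ 1%R) => //; first exact: bmeas_indic.
by move=> x; apply: cvg_near_cst; exact: Slim.
Unshelve. all: by end_near. Qed.

HB.instance Definition _ := isMeasure.Build _ _ _ functional_measure
  measure0 measure_ge0 measure_sigma_additive.

Let measure_setT : functional_measure setT = 1.
Proof.
by rewrite functional_measureE// indicT; congr EFin; case: mL.
Qed.

HB.instance Definition _ := Measure_isProbability.Build _ _ _
  functional_measure measure_setT.

Lemma functional_probability : exists pi : probability T R,
  forall A, measurable A -> pi A = (L \1_A)%:E.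
Proof.
by exists (functional_measure : probability T R); exact: functional_measureE.
Qed.

End functional_measure.

Section domination.
Context d (T : measurableType d) (R : realType).
Local Open Scope ereal_scope.

Lemma ge0_integral_minorized (mu nu : {measure set T -> \bar R}) (a : R)
    (f : T -> \bar R) : (0 <= a)%R ->
  (forall A, measurable A -> a%:E * nu A <= mu A) ->
  (forall x, 0 <= f x) -> measurable_fun setT f ->
  a%:E * \int[nu]_x f x <= \int[mu]_x f x.
Proof.
move=> a0 numu f0 mf; pose k := NngNum a0.
rewrite -[a]/(k%:num) -ge0_integral_mscale//.
by apply: ge0_le_measure_integral => // S mS; exact: numu.
Qed.

Lemma minorized_integrable (mu nu : {measure set T -> \bar R}) (a : R)
    (f : T -> R) : (0 < a)%R ->
  (forall A, measurable A -> a%:E * nu A <= mu A) ->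
  mu.-integrable setT (EFin \o f) -> nu.-integrable setT (EFin \o f).
Proof.
move=> a0 numu /integrableP[mf fi]; apply/integrableP; split => //.
have mabs : measurable_fun setT (fun x => `|(EFin \o f) x|).
  exact: measurableT_comp.
have := ge0_integral_minorized (ltW a0) numu (fun x => abse_ge0 (f x)%:E) mabs.
move=> /le_lt_trans/(_ fi) h; rewrite ltNge leye_eq; apply/negP => /eqP foo.
by move: h; rewrite foo gt0_muley ?lte_fin// ltxx.
Qed.

Lemma Rintegral_minorized (mu nu : {measure set T -> \bar R}) (a : R)
    (f : T -> R) : (0 < a)%R ->
  (forall A, measurable A -> a%:E * nu A <= mu A) ->
  mu.-integrable setT (EFin \o f) -> (forall x, 0 <= f x)%R ->
  (a * \int[nu]_x f x <= \int[mu]_x f x)%R.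
Proof.
move=> a0 numu fi f0; have nfi := minorized_integrable a0 numu fi.
rewrite -lee_fin EFinM /Rintegral !fineK; last 2 first.
- exact: integrable_fin_num.
- exact: integrable_fin_num.
apply: ge0_integral_minorized => //; first exact: ltW.
by case/integrableP: fi.
Qed.

End domination.

Section integrable_EFin.
Context d (T : measurableType d) (R : realType) (mu : {measure set T -> \bar R}).
Implicit Types f g : T -> R.

Lemma integrable_EFinZ r f : mu.-integrable setT (EFin \o f) ->
  mu.-integrable setT (EFin \o (fun x => r * f x)).
Proof. by move=> /(integrableZl measurableT r); apply: eq_integrable. Qed.

Lemma integrable_EFinD f g : mu.-integrable setT (EFin \o f) ->
  mu.-integrable setT (EFin \o g) ->
  mu.-integrable setT (EFin \o (fun x => f x + g x)).
Proof.
by move=> fi gi; have := integrableD measurableT fi gi; apply: eq_integrable.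
Qed.

Lemma integrable_EFinB f g : mu.-integrable setT (EFin \o f) ->
  mu.-integrable setT (EFin \o g) ->
  mu.-integrable setT (EFin \o (fun x => f x - g x)).
Proof.
by move=> fi gi; have := integrableB measurableT fi gi; apply: eq_integrable.
Qed.

End integrable_EFin.

Section harris.
Context d (T : measurableType d) (R : realType) (P : T -> probability T R).
Hypothesis mP : forall A, measurable A -> measurable_fun setT (fun x => P x A).
Context (E : T -> R) (beta c : R).
Hypothesis mE : measurable_fun setT E.
Hypothesis E0 : forall x, 0 <= E x.
Hypothesis beta01 : 0 < beta < 1.
Hypothesis c0 : 0 < c.
Hypothesis lyapunov :
  forall x, (\int[P x]_y (E y)%:E <= ((1 - beta) * E x + c)%:E)%E.
Hypothesis minorized : forall M, exists (a : R) (nu : probability T R),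
  0 < a /\ forall x, E x <= M ->
  forall A, measurable A -> (a%:E * nu A <= P x A)%E.

Lemma integrable_lyapunov x : (P x).-integrable setT (EFin \o E).
Proof.
apply/integrableP; split; first exact/measurable_EFinP.
under eq_integral do rewrite /= ger0_norm//.
by rewrite (le_lt_trans (lyapunov x))// ltry.
Qed.

Lemma Rintegral_lyapunov x : \int[P x]_y E y <= (1 - beta) * E x + c.
Proof.
rewrite -lee_fin /Rintegral fineK; first exact: lyapunov.
exact: (integrable_fin_num measurableT (integrable_lyapunov x)).
Qed.

Lemma integrable_weight (mu : probability T R) s b :
  mu.-integrable setT (EFin \o E) ->
  mu.-integrable setT (EFin \o (fun y => s * (1 + b * E y))).
Proof.
move=> iE; apply/integrable_EFinZ/integrable_EFinD.
  exact/bmeas_integrable/bmeas_cst.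
exact: integrable_EFinZ.
Qed.

Lemma Rintegral_weight (mu : probability T R) s b :
  mu.-integrable setT (EFin \o E) ->
  \int[mu]_y (s * (1 + b * E y)) = s * (1 + b * \int[mu]_y E y).
Proof.
move=> iE; have ibE : mu.-integrable setT (EFin \o (fun y => b * E y)).
  exact: integrable_EFinZ.
have i1 := bmeas_integrable mu (bmeas_cst T (1 : R)).
rewrite RintegralZl//; last exact: integrable_EFinD i1 ibE.
rewrite RintegralD// RintegralZl//.
by rewrite (mean_functional_cst (mean_functional_Rintegral mu)).
Qed.

(* Centering f at a well-chosen constant turns the oscillation bound into a
   bound of f by a weight (Hairer and Mattingly). *)
Lemma center_oscillation f s b : 0 <= s -> 0 <= b -> bmeas f ->
  (forall x y, `|f x - f y| <= s * (2 + b * E x + b * E y)) ->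
  exists m, forall x, `|f x - m| <= s * (1 + b * E x).
Proof.
move=> s0 b0 bf osc.
(* By the oscillation bound every [f y - s * (1 + b * E y)] lies below every
   [f x + s * (1 + b * E x)]; the supremum of the former separates the two families. *)
pose S := [set z | exists y, z = f y - s * (1 + b * E y)].
have ub x : ubound S (f x + s * (1 + b * E x)).
  move=> _ [y ->]; have := osc y x; rewrite ler_norml => /andP[_].
  by rewrite lerBlDr; lra.
have [m mP'] : exists m, forall x, f x - s * (1 + b * E x) <= m /\
    m <= f x + s * (1 + b * E x).
  exists (sup S) => x; split.
    apply: sup_upper_bound; last by exists x.
    by split; [exists (f x - s * (1 + b * E x)), x|exists (f x + s * (1 + b * E x))].
  apply: sup_le_ub; last exact: ub.
  by exists (f x - s * (1 + b * E x)), x.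
by exists m => x; have [] := mP' x; rewrite ler_distl => *; apply/andP; split; lra.
Qed.

(** If [E x + E y] is large, the drift alone contracts the weight. Otherwise both states lie in the
    small set, and the common part [a * nu] cancels in the difference of the two means. Either way
    the bound is at most [s * (2 - a + (1 - beta / 2) * b * (E x + E y))], whence [r]. *)
Lemma markov_op_contraction : exists r b : R, [/\ 0 < r < 1, 0 < b &
  forall f s, 0 <= s -> bmeas f ->
    (forall x y, `|f x - f y| <= s * (2 + b * E x + b * E y)) ->
    forall x y, `|markov_op P f x - markov_op P f y| <=
      r * s * (2 + b * E x + b * E y)].
Proof.
have /andP[beta0 beta1] := beta01.
have [a [nu [a0 minor]]] := minorized (8 * c / beta).
(* With [b * c = a / 2] the drift constants of [x] and [y] together add only [a] to the weight. The
   minorization takes back [2 * a], and so does half of the drift once [E x + E y] reaches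
   [8 * c / beta]. *)
pose b := a / (2 * c); pose r := Num.max (1 - a / 2) (1 - beta / 2).
have b0 : 0 < b by rewrite divr_gt0// mulr_gt0.
have bc : b * c = a / 2 by rewrite /b; field; rewrite gt_eqF.
have ra : 1 - a / 2 <= r by rewrite le_max lexx.
have rb : 1 - beta / 2 <= r by rewrite le_max lexx orbT.
have r0 : 0 < r by lra.
have r1 : r < 1 by rewrite gt_max; apply/andP; split; lra.
exists r, b; split => //; first by rewrite r0 r1.
move=> f s s0 bf osc x y.
have [m fm] := center_oscillation s0 (ltW b0) bf osc.
pose w z := s * (1 + b * E z).
have bh : bmeas (fun z => f z - m) by exact: bmeasD bf (bmeas_cst _ (- m)).
have iE z := integrable_lyapunov z.
have iw z := integrable_weight s b (iE z).
have ih z := bmeas_integrable (P z) bh.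
have PfE z : markov_op P f z = \int[P z]_v (f v - m) + m.
  have mI := mean_functional_Rintegral (P z).
  rewrite (mean_functionalB mI)//; last exact: bmeas_cst.
  by rewrite (mean_functional_cst mI) subrK.
have hw z : - w z <= f z - m <= w z by rewrite -ler_norml; exact: fm.
have Iw z : \int[P z]_v w v <= s * (1 + b * ((1 - beta) * E z + c)).
  rewrite /w (Rintegral_weight s b (iE z)); apply: ler_wpM2l => //.
  rewrite lerD2l; apply: ler_wpM2l; first exact: ltW.
  exact: Rintegral_lyapunov.
have X0 : 0 <= E x + E y by rewrite addr_ge0.
have -> : 2 + b * E x + b * E y = 2 + b * (E x + E y) by ring.
have bX0 : 0 <= b * (E x + E y) by rewrite mulr_ge0// ltW.
suff key : `|\int[P x]_v (f v - m) - \int[P y]_v (f v - m)| <=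
    s * (r * (2 + b * (E x + E y))).
  rewrite !PfE [r * s]mulrC -mulrA.
  by rewrite (_ : _ + m - (_ + m) = \int[P x]_v (f v - m) -
    \int[P y]_v (f v - m))//; ring.
have [xybig|xysmall] := leP (8 * c / beta) (E x + E y).
  have Ih z : `|\int[P z]_v (f v - m)| <= \int[P z]_v w v.
    rewrite ler_norml; apply/andP; split; last first.
      apply: (le_Rintegral measurableT (ih z) (iw z)) => v _.
      by have /andP[] := hw v.
    rewrite lerNl -mulN1r -RintegralZl//; last exact: ih.
    apply: (le_Rintegral measurableT (integrable_EFinZ _ (ih z)) (iw z)) => v _.
    by rewrite mulN1r lerNl; have /andP[] := hw v.
  have le1 := ler_normB (\int[P x]_v (f v - m)) (\int[P y]_v (f v - m)).
  have le2 := lerD (le_trans (Ih x) (Iw x)) (le_trans (Ih y) (Iw y)).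
  apply: (le_trans (le_trans le1 le2)).
  rewrite -mulrDr ler_wpM2l//.
  have h8 : 8 * c <= beta * (E x + E y).
    by move: xybig; rewrite ler_pdivrMr// [leRHS]mulrC.
  have h4 : 2 * a <= beta * (b * (E x + E y)) / 2.
    have := ler_wpM2l (ltW b0) h8; lra.
  have h5 : (1 - beta / 2) * (b * (E x + E y)) <= r * (b * (E x + E y)).
    exact: ler_wpM2r.
  lra.
have Ex : E x <= 8 * c / beta by have := E0 y; lra.
have Ey : E y <= 8 * c / beta by have := E0 x; lra.
have iEnu := minorized_integrable a0 (minor x Ex) (iE x).
have iwnu := integrable_weight s b iEnu.
have ihnu := bmeas_integrable nu bh.
(* [up] and [lo] apply the minorization to the nonnegative [w - h] and [w + h], where [h] is the
   centred [f]; the [nu]-mean of [h] enters identically for [x] and [y] and disappears from their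
   difference. *)
have up z : E z <= 8 * c / beta -> \int[P z]_v (f v - m) <=
    (\int[P z]_v w v) - a * (\int[nu]_v w v) + a * \int[nu]_v (f v - m).
  move=> Ez.
  have wh v : 0 <= w v - (f v - m) by rewrite subr_ge0; have /andP[] := hw v.
  have := Rintegral_minorized a0 (minor z Ez) (integrable_EFinB (iw z) (ih z)) wh.
  rewrite (RintegralB measurableT iwnu ihnu).
  by rewrite (RintegralB measurableT (iw z) (ih z)); lra.
have lo z : E z <= 8 * c / beta ->
    - (\int[P z]_v w v) + a * (\int[nu]_v w v) + a * (\int[nu]_v (f v - m)) <=
    \int[P z]_v (f v - m).
  move=> Ez; have wh v : 0 <= w v + (f v - m) by have /andP[] := hw v; lra.
  have := Rintegral_minorized a0 (minor z Ez) (integrable_EFinD (iw z) (ih z)) wh.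
  rewrite (RintegralD measurableT iwnu ihnu).
  by rewrite (RintegralD measurableT (iw z) (ih z)); lra.
have nuw : s <= \int[nu]_v w v.
  rewrite /w (Rintegral_weight s b iEnu) ler_peMr// lerDl.
  by apply: mulr_ge0; [exact: ltW|exact: Rintegral_ge0].
have upx := up x Ex; have upy := up y Ey.
have lox := lo x Ex; have loy := lo y Ey.
have Iwx := Iw x; have Iwy := Iw y.
apply: (@le_trans _ _ (s * (2 - a + (1 - beta) * (b * (E x + E y))))).
  have anuw : a * s <= a * \int[nu]_v w v by rewrite ler_wpM2l// ltW.
  have bcs : s * (b * c) = s * (a / 2) by rewrite bc.
  by rewrite ler_norml; apply/andP; split; lra.
apply: ler_wpM2l => //; rewrite [leRHS]mulrDr; apply: lerD; first lra.
by apply: ler_wpM2r => //; lra.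
Qed.

End harris.

Section harris_limit.
Context d (T : measurableType d) (R : realType) (P : T -> probability T R).
Hypothesis mP : forall A, measurable A -> measurable_fun setT (fun x => P x A).
Context (E : T -> R) (b c r : R).
Hypothesis E0 : forall x, 0 <= E x.
Hypothesis b0 : 0 < b.
Hypothesis r01 : 0 < r < 1.
Hypothesis iE : forall x, (P x).-integrable setT (EFin \o E).
Hypothesis lyapunov : forall x, \int[P x]_y E y <= E x + c.
Hypothesis contraction : forall f s, 0 <= s -> bmeas f ->
  (forall x y, `|f x - f y| <= s * (2 + b * E x + b * E y)) ->
  forall x y, `|markov_op P f x - markov_op P f y| <=
    r * s * (2 + b * E x + b * E y).
Implicit Type f : T -> R.

Let bE_ge0 x : 0 <= b * E x.
Proof. by apply: mulr_ge0 => //; exact: ltW. Qed.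

Let rX_ge0 n : 0 <= r ^+ n.
Proof. by case/andP: r01 => r0 _; rewrite exprn_ge0// ltW. Qed.

Let cvg_rX : r ^+ n @[n --> \oo] --> 0.
Proof. by case/andP: r01 => r0 r1; apply: cvg_expr; rewrite ger0_norm// ltW. Qed.

Lemma markov_iter_contraction n f M : bmeas f -> (forall x, `|f x| <= M) ->
  forall x y, `|markov_iter P n f x - markov_iter P n f y| <=
    r ^+ n * M * (2 + b * E x + b * E y).
Proof.
move=> bf fM x0; have M0 : 0 <= M := le_trans (normr_ge0 _) (fM x0).
move: x0; elim: n => [|n IHn] x y; last first.
  rewrite exprS -(mulrA r); apply: contraction => //; first exact: mulr_ge0.
  exact: bmeas_markov_iter.
have le2 := le_trans (ler_normB (f x) (f y)) (lerD (fM x) (fM y)).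
apply: le_trans le2 _; rewrite expr0 mul1r.
have h1 := mulr_ge0 M0 (bE_ge0 x); have h2 := mulr_ge0 M0 (bE_ge0 y).
lra.
Qed.

(** By the drift inequality, an upper bound for the mean over [y] under [P x] of the weight
    [2 + b * E x + b * E y]. *)
Definition drift x := 2 + 2 * (b * E x) + b * c.

Lemma drift_ge0 x : 0 <= drift x.
Proof.
have Ec : 0 <= E x + c.
  by apply: le_trans (lyapunov x); exact: Rintegral_ge0.
have := mulr_ge0 (ltW b0) Ec; have := bE_ge0 x; rewrite /drift mulrDr; lra.
Qed.

(** The increment at [x] is the mean under [P x] of [g y - g x], with [g] the [n]-th iterate, so the
    oscillation bound controls it. *)
Lemma markov_iter_step n f M x : bmeas f -> (forall x, `|f x| <= M) ->
  `|markov_iter P n.+1 f x - markov_iter P n f x| <= M * drift x * r ^+ n.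
Proof.
move=> bf fM; have M0 : 0 <= M := le_trans (normr_ge0 _) (fM x).
have osc := markov_iter_contraction n bf fM.
have bg := bmeas_markov_iter mP n bf.
rewrite [markov_iter P n.+1 f]/(markov_op P (markov_iter P n f)).
move: (markov_iter P n f) osc bg => g osc bg.
have mI := mean_functional_Rintegral (P x).
have -> : markov_op P g x - g x = \int[P x]_y (g y - g x).
  by rewrite (mean_functionalB mI)// ?(mean_functional_cst mI)//; exact: bmeas_cst.
have bgx : bmeas (fun y => g y - g x) by exact: bmeasD bg (bmeas_cst _ (- g x)).
have ig := bmeas_integrable (P x) bgx.
set s := r ^+ n * M; have s0 : 0 <= s by exact: mulr_ge0.
have ibE : (P x).-integrable setT (EFin \o (fun y => s * b * E y)).
  exact: integrable_EFinZ (iE x).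
have ik := bmeas_integrable (P x) (bmeas_cst T (s * (2 + b * E x))).
have iw := integrable_EFinD ik ibE.
apply: le_trans (le_normr_Rintegral measurableT ig) _.
apply: (@le_trans _ _ (\int[P x]_y (s * (2 + b * E x) + s * b * E y))).
  apply: (le_Rintegral measurableT (integrable_norm ig) iw) => y _.
  by rewrite /=; apply: le_trans (osc y x) _; rewrite -/s le_eqVlt; apply/predU1P; left; ring.
rewrite (RintegralD measurableT ik ibE) (RintegralZl (s * b) measurableT (iE x)).
rewrite (mean_functional_cst mI).
rewrite [leRHS](_ : _ = s * (2 + 2 * (b * E x) + b * c)); last first.
  by rewrite /s /drift; ring.
by have := ler_wpM2l (mulr_ge0 s0 (ltW b0)) (lyapunov x); lra.
Qed.

Let K x := drift x / (1 - r).

Let K_ge0 x : 0 <= K x.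
Proof.
case/andP: r01 => r0 r1.
by apply: divr_ge0; [exact: drift_ge0|rewrite subr_ge0 ltW].
Qed.

(** The future integral against the invariant law. The base state [point] is arbitrary: by
    [markov_iter_limit_mean] the iterates have the same limit at every state. *)
Definition limit_mean f := limn (fun n => markov_iter P n f point).

Lemma limit_meanP f M : bmeas f -> (forall x, `|f x| <= M) ->
  markov_iter P n f point @[n --> \oo] --> limit_mean f /\
  forall n, `|markov_iter P n f point - limit_mean f| <= M * K point * r ^+ n.
Proof.
move=> bf fM; have M0 : 0 <= M := le_trans (normr_ge0 _) (fM point).
have [l [ul le_l]] := cvg_geometric_steps (mulr_ge0 M0 (drift_ge0 point)) r01
  (fun n => markov_iter_step n point bf fM).
have El : limit_mean f = l by exact: (cvg_lim (@Rhausdorff R) ul).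
by rewrite El; split => // n; rewrite /K mulrA.
Qed.

Lemma cvg_limit_mean f : bmeas f ->
  markov_iter P n f point @[n --> \oo] --> limit_mean f.
Proof. by move=> bf; have [_ [M fM]] := bf; have [] := limit_meanP bf fM. Qed.

Lemma limit_mean_unique f l : bmeas f ->
  markov_iter P n f point @[n --> \oo] --> l -> limit_mean f = l.
Proof. by move=> bf fl; exact: (cvg_lim (@Rhausdorff R) fl). Qed.

Lemma mean_functional_limit_mean : mean_functional limit_mean.
Proof.
have mI n := mean_functional_markov_iter mP n point.
split => [f g bf bg|s f bf|f g bf bg fg|].
- apply: limit_mean_unique; first exact: bmeasD.
  rewrite (_ : (fun n => _) =
    (fun n => markov_iter P n f point + markov_iter P n g point)).
    by apply: cvgD; exact: cvg_limit_mean.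
  by apply/funext => n; have [->] := mI n.
- apply: limit_mean_unique; first exact: bmeasZ.
  rewrite (_ : (fun n => _) = (fun n => s * markov_iter P n f point)).
    by apply: cvgM; [exact: cvg_cst|exact: cvg_limit_mean].
  by apply/funext => n; have [_ ->] := mI n.
- apply: ler_lim; [apply/cvg_ex; eexists; exact: cvg_limit_mean..|].
  by apply: nearW => n; have [_ _ ->] := mI n.
- apply: limit_mean_unique; first exact: bmeas_cst.
  rewrite (_ : (fun n => _) = fun=> 1); first exact: cvg_cst.
  by apply/funext => n; rewrite (mean_functional_cst (mI n)).
Qed.

(** The rate in [limit_meanP] depends on the function only through its bound. One [n] thus brings
    the iterates within [e / 3] of their limits for [f] and all [f_ k] at once, and for that [n]
    bounded convergence applies. *)
Lemma limit_mean_pointwise_continuous : pointwise_continuous limit_mean.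
Proof.
move=> f_ f M bf_ fM bf cf; have [_ [N fN]] := bf.
have M0 : 0 <= M := le_trans (normr_ge0 _) (fM 0%N point).
have N0 : 0 <= N := le_trans (normr_ge0 _) (fN point).
apply/cvgrPdist_lt => e e0.
have e3 : 0 < e / 3 by rewrite divr_gt0.
have : (M + N) * K point * r ^+ n @[n --> \oo] --> 0.
  by rewrite -(mulr0 ((M + N) * K point)); apply: cvgM => //; exact: cvg_cst.
move=> /cvgrPdist_lt/(_ _ e3)[n _ /(_ n (leqnn n))].
rewrite sub0r normrN ger0_norm; last first.
  by do 2 apply: mulr_ge0 => //; exact: addr_ge0.
move=> ne; have close g : bmeas g -> (forall x, `|g x| <= M + N) ->
    `|markov_iter P n g point - limit_mean g| < e / 3.
  by move=> bg gMN; apply: le_lt_trans ne; have [_] := limit_meanP bg gMN.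
have cn := @markov_iter_pointwise_continuous _ _ _ P mP n point _ _ _ bf_ fM bf cf.
move/cvgrPdist_lt: cn => /(_ _ e3); apply: filterS => k fk.
have h1 : `|markov_iter P n f point - limit_mean f| < e / 3.
  by apply: close => // x; rewrite (le_trans (fN x))// lerDr.
have h2 : `|markov_iter P n (f_ k) point - limit_mean (f_ k)| < e / 3.
  by apply: close => // x; rewrite (le_trans (fM k x))// lerDl.
by move: fk h1 h2; rewrite !ltr_norml; lra.
Qed.

Lemma limit_mean_markov_op f : bmeas f -> limit_mean (markov_op P f) = limit_mean f.
Proof.
move=> bf; apply: limit_mean_unique; first exact: bmeas_markov_op.
rewrite (_ : (fun n => _) = (fun n => markov_iter P n.+1 f point)).
  by rewrite (cvg_shiftS (fun n => markov_iter P n f point)); exact: cvg_limit_mean.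
by apply/funext => n; rewrite /markov_iter iterSr.
Qed.

Lemma markov_iter_limit_mean n f M x : bmeas f -> (forall x, `|f x| <= M) ->
  `|markov_iter P n f x - limit_mean f| <=
  (2 + b * E point + b + K point) * M * r ^+ n * (1 + E x).
Proof.
move=> bf fM; have M0 : 0 <= M := le_trans (normr_ge0 _) (fM point).
have [_ /(_ n) h1] := limit_meanP bf fM.
have h2 := markov_iter_contraction n bf fM x point.
have h3 := ler_normD (markov_iter P n f x - markov_iter P n f point)
  (markov_iter P n f point - limit_mean f).
rewrite subrKA in h3; apply: le_trans h3 _; apply: le_trans (lerD h2 h1) _.
set s := r ^+ n * M; have s0 : 0 <= s by exact: mulr_ge0.
rewrite [leLHS](_ : _ = s * (2 + b * E x + b * E point + K point)); last first.
  by rewrite /s; ring.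
rewrite [leRHS](_ : _ = s * ((2 + b * E point + b + K point) * (1 + E x))).
  apply: ler_wpM2l => //.
  have h4 := mulr_ge0 (bE_ge0 point) (E0 x).
  have h5 := mulr_ge0 (K_ge0 point) (E0 x).
  by have := E0 x; have := ltW b0; lra.
by rewrite /s; ring.
Qed.

End harris_limit.

Section harris_theorem.
Context d (T : measurableType d) (R : realType) (P : T -> probability T R).
Hypothesis mP : forall A, measurable A -> measurable_fun setT (fun x => P x A).
Context (E : T -> R) (beta c : R).
Hypothesis mE : measurable_fun setT E.
Hypothesis E0 : forall x, 0 <= E x.
Hypothesis beta01 : 0 < beta < 1.
Hypothesis c0 : 0 < c.
Hypothesis lyapunov :
  forall x, (\int[P x]_y (E y)%:E <= ((1 - beta) * E x + c)%:E)%E.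
Hypothesis minorized : forall M, exists (a : R) (nu : probability T R),
  0 < a /\ forall x, E x <= M ->
  forall A, measurable A -> (a%:E * nu A <= P x A)%E.

Lemma Rintegral_indic (mu : probability T R) A : measurable A ->
  \int[mu]_x \1_A x = fine (mu A).
Proof. by move=> mA; rewrite /Rintegral integral_indic// setIT. Qed.

Lemma mean_functional_01 (L : (T -> R) -> R) f : mean_functional L -> bmeas f ->
  (forall x, 0 <= f x <= 1) -> 0 <= L f <= 1.
Proof.
move=> mL bf f01; have [_ _ Lle _] := mL.
rewrite -{1}(mean_functional_cst mL 0) -(mean_functional_cst mL 1).
by apply/andP; split; apply: Lle => //; try (exact: bmeas_cst);
  move=> x; have /andP[] := f01 x.
Qed.

Lemma norm_indic_le1 (A : set T) x : `|\1_A x| <= 1 :> R.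
Proof. by rewrite indicE; case: (_ \in _); rewrite ?normr1 ?normr0. Qed.

Theorem harris : exists pi : probability T R,
  [/\ forall A, measurable A -> (\int[pi]_x P x A = pi A)%E,
      forall pi' : probability T R,
        (forall A, measurable A -> (\int[pi']_x P x A = pi' A)%E) ->
        forall A, measurable A -> pi' A = pi A &
      exists r kappa : R, [/\ 0 < r < 1, 0 < kappa &
        forall n A x, measurable A ->
          `|markov_iter P n \1_A x - fine (pi A)| <= kappa * r ^+ n * (1 + E x)]].
Proof.
have [r [b [r01 b0 contr]]] :=
  markov_op_contraction mE E0 beta01 c0 lyapunov minorized.
have iE x := integrable_lyapunov mE E0 lyapunov x.
have lyap x : \int[P x]_y E y <= E x + c.
  have := Rintegral_lyapunov mE E0 lyapunov x => /le_trans; apply.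
  have /andP[beta0 _] := beta01.
  by have := mulr_ge0 (ltW beta0) (E0 x); lra.
have mL := mean_functional_limit_mean mP E0 b0 r01 iE lyap contr.
have cL := limit_mean_pointwise_continuous mP E0 b0 r01 iE lyap contr.
have LP := limit_mean_markov_op mP E0 b0 r01 iE lyap contr.
set L := limit_mean P in mL cL LP.
have [pi piE] := functional_probability mL cL.
have PE (mu : probability T R) A : measurable A ->
    (\int[mu]_x P x A)%E = (\int[mu]_x markov_op P \1_A x)%:E.
  move=> mA; rewrite /Rintegral fineK.
    by apply: eq_integral => x _; rewrite (markov_op_indic P x mA).
  apply: (integrable_fin_num measurableT).
  exact/bmeas_integrable/bmeas_markov_op/bmeas_indic.
have P01 (f : T -> R) : bmeas f -> (forall x, 0 <= f x <= 1) ->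
    forall x, 0 <= markov_op P f x <= 1.
  by move=> bf f01 x; exact: mean_functional_01 (mean_functional_Rintegral _) _ _.
have I01 (A : set T) x : 0 <= (\1_A x : R) <= 1.
  by rewrite indicE; case: (_ \in _); rewrite ?lexx ?ler01.
have It01 n A : measurable A -> forall x, 0 <= markov_iter P n \1_A x <= 1.
  move=> mA x; apply: (mean_functional_01 (mean_functional_markov_iter mP n x)).
    exact: bmeas_indic.
  exact: I01.
have rate n A x : measurable A -> `|markov_iter P n \1_A x - L \1_A| <=
    (2 + b * E point + b + drift E b c point / (1 - r)) * r ^+ n * (1 + E x).
  move=> mA; have := markov_iter_limit_mean mP E0 b0 r01 iE lyap contr n x
    (bmeas_indic R mA) (norm_indic_le1 A).
  by rewrite mulr1.
exists pi; split.
- move=> A mA; rewrite PE// piE//; congr EFin.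
  have bA := bmeas_indic R mA.
  transitivity (L (markov_op P \1_A)); last exact: LP.
  (* [pi] was built from the values of [L] on sets; agreement has to be extended to [[0, 1]]-valued
     functions. *)
  apply: (mean_functional_unique (mean_functional_Rintegral pi) mL).
  + by move=> B mB; rewrite Rintegral_indic// piE.
  + exact: measurable_markov_op.
  + exact: P01.
- move=> pi' inv A mA.
  have mI' := mean_functional_Rintegral pi'.
  have inv' (f : T -> R) : measurable_fun setT f -> (forall x, 0 <= f x <= 1) ->
      \int[pi']_x markov_op P f x = \int[pi']_x f x.
    apply: (mean_functional_unique (mean_functional_markov_op mP mI') mI').
    by move=> B mB; apply: EFin_inj; rewrite -PE// inv// Rintegral_indic// fineK//
      fin_num_measure.
  have invn n : \int[pi']_x markov_iter P n \1_A x = \int[pi']_x \1_A x.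
    elim: n => [//|n IHn]; rewrite -IHn; apply: inv'; last exact: It01.
    by case: (bmeas_markov_iter mP n (bmeas_indic R mA)).
  (* By invariance these integrals are constant in [n]. Bounded convergence uses the rate only
     pointwise, so [E] may have infinite mean under [pi']. *)
  have : \int[pi']_x markov_iter P n \1_A x @[n --> \oo] --> \int[pi']_x (L \1_A).
    apply: (@Rintegral_pointwise_continuous _ _ _ pi' _ _ 1).
    + by move=> n; apply: bmeas_markov_iter => //; exact: bmeas_indic.
    + by move=> n x; have /andP[p0 p1] := It01 n A mA x; rewrite ger0_norm.
    + exact: bmeas_cst.
    + move=> x; apply/cvgrPdist_le => e e0.
      have : (2 + b * E point + b + drift E b c point / (1 - r)) * r ^+ n * (1 + E x)
          @[n --> \oo] --> 0.
        rewrite -(mul0r (1 + E x)); apply: cvgM; last exact: cvg_cst.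
        rewrite -(mulr0 (2 + b * E point + b + drift E b c point / (1 - r))).
        apply: cvgM; first exact: cvg_cst.
        by have /andP[r0 r1] := r01; apply: cvg_expr; rewrite ger0_norm// ltW.
      move=> /cvgrPdist_le/(_ _ e0); apply: filterS => n.
      rewrite sub0r normrN => /(le_trans (ler_norm _)).
      by apply: le_trans; rewrite distrC; exact: rate.
  rewrite (_ : (fun n => _) = fun=> \int[pi']_x \1_A x); last exact/funext.
  move=> /(cvg_lim (@Rhausdorff R)); rewrite lim_cst//.
  rewrite (mean_functional_cst mI') Rintegral_indic// => h.
  by rewrite piE// -h fineK// fin_num_measure.
- exists r, (2 + b * E point + b + drift E b c point / (1 - r)); split => //.
    have /andP[_ r1] := r01.
    have h1 : 0 <= drift E b c point / (1 - r).
      apply: divr_ge0; last by rewrite subr_ge0 ltW.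
      exact: (drift_ge0 E0 b0 lyap).
    by have := mulr_ge0 (ltW b0) (E0 point); lra.
  by move=> n A x mA; rewrite piE//=; exact: rate.
Qed.

End harris_theorem.

(** * Kernels and domination for product measures *)

Section probability_of_measure.
Context d (T : measurableType d) (R : realType) (mu : {measure set T -> \bar R}).
Hypothesis mu1 : mu setT = 1%E.

Let nu : set T -> \bar R := mu.

HB.instance Definition _ := Measure.on nu.
HB.instance Definition _ := Measure_isProbability.Build _ _ _ nu mu1.

Lemma probability_of_measure : exists pi : probability T R, forall A, pi A = mu A.
Proof. by exists (nu : probability T R). Qed.

End probability_of_measure.

Section finite_kernel.
Context d1 d2 (X : measurableType d1) (Y : measurableType d2) (R : realType).
Context (l : X -> {measure set Y -> \bar R}).
Hypothesis ml : forall A, measurable A -> measurable_fun setT (fun x => l x A).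
Hypothesis l1 : forall x, l x setT = 1%E.

Let k : X -> {measure set Y -> \bar R} := l.
HB.instance Definition _ := isKernel.Build _ _ _ _ _ k ml.

Let k_uub : measure_fam_uub k.
(* The uniform bound has to be strict, hence [2] for masses equal to [1]. *)
Proof. by exists 2 => x; rewrite /k l1 lte_fin ltr1n. Qed.
HB.instance Definition _ := Kernel_isFinite.Build _ _ _ _ _ k k_uub.

Lemma measurable_fun_section (A : set (X * Y)) : measurable A ->
  measurable_fun setT (fun x => l x (xsection A x)).
Proof.
by move=> mA; apply: (measurable_fun_xsection_finite_kernel k); rewrite inE.
Qed.

Lemma measurable_fun_integral_kernel2 (f : X * Y -> \bar R) :
  (forall z, 0 <= f z)%E -> measurable_fun setT f ->
  measurable_fun setT (fun x => \int[l x]_y f (x, y))%E.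
Proof. exact: (measurable_fun_integral_finite_kernel f k). Qed.

End finite_kernel.

Section product_kernel.
Context d (X : measurableType d) (R : realType).
Local Open Scope ereal_scope.

Lemma product_measure_setT d1 d2 (Y1 : measurableType d1) (Y2 : measurableType d2)
    (m1 : {measure set Y1 -> \bar R}) (m2 : {sigma_finite_measure set Y2 -> \bar R}) :
  m1 setT = 1 -> m2 setT = 1 -> (m1 \x m2) setT = 1.
Proof.
move=> m11 m21; rewrite /product_measure1.
have xT x : xsection [set: Y1 * Y2] x = setT.
  by apply/seteqP; split => y // _; rewrite /xsection /= inE.
under eq_integral do rewrite /= xT m21.
by rewrite integral_cst// mul1e.
Qed.

(** Both the measure and the integrand depend on [x]. Taking the pair in [X * Y1] as parameter of
    the inner kernel makes the integrand jointly measurable, and the outer kernel then integrates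
    it. *)
Lemma measurable_product_kernel d1 d2 (Y1 : measurableType d1)
    (Y2 : measurableType d2) (l1 : X -> {measure set Y1 -> \bar R})
    (l2 : X -> {sigma_finite_measure set Y2 -> \bar R}) :
  (forall x, l1 x setT = 1) -> (forall x, l2 x setT = 1) ->
  (forall A, measurable A -> measurable_fun setT (fun x => l1 x A)) ->
  (forall A, measurable A -> measurable_fun setT (fun x => l2 x A)) ->
  forall A, measurable A -> measurable_fun setT (fun x => (l1 x \x l2 x) A).
Proof.
move=> l11 l21 ml1 ml2 A mA.
pose B : set ((X * Y1) * Y2) := [set z | A (z.1.2, z.2)].
have mB : measurable B.
  rewrite -[X in measurable X]setTI.
  have : measurable_fun setT (fun z : (X * Y1) * Y2 => (z.1.2, z.2)).
    apply/measurable_fun_pair => //=.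
    exact: measurableT_comp measurable_snd measurable_fst.
  by apply.
apply: (measurable_fun_integral_kernel2 ml1 l11
  (f := fun z => l2 z.1 (xsection A z.2))) => [z|]; first exact: measure_ge0.
rewrite (_ : (fun z => _) = (fun z : X * Y1 => l2 z.1 (xsection B z))).
  apply: (measurable_fun_section (l := fun z : X * Y1 => l2 z.1)) => // [|z].
    by move=> C mC; exact: measurableT_comp (ml2 C mC) measurable_fst.
  exact: l21.
by apply/funext => -[].
Qed.

Lemma prod_measure_setT d1 (Y : measurableType d1) n
    (mu : 'I_n -> probability Y R) :
  prod_measure (fun i => mu i) setT = 1.
Proof.
elim: n mu => [|n IHn] mu /=; first by rewrite diracT.
rewrite /cons_measure /pushforward preimage_setT.
apply: product_measure_setT; last exact: (IHn (fun i => mu (lift ord0 i))).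
exact: (@probability_setT _ _ _ (mu ord0)).
Qed.

Lemma measurable_prod_kernel d1 (Y : measurableType d1) n
    (l : X -> 'I_n -> probability Y R) :
  (forall i A, measurable A -> measurable_fun setT (fun x => l x i A)) ->
  forall A, measurable A ->
    measurable_fun setT (fun x => prod_measure (fun i => l x i) A).
Proof.
elim: n l => [|n IHn] l ml A mA /=; first exact: measurable_cst.
have mA' : measurable (@cons_pair _ Y n @^-1` A).
  by rewrite -[X in measurable X]setTI; exact: measurable_cons_pair.
apply: (measurable_product_kernel (l1 := fun x => l x ord0)
  (l2 := fun x => prod_measure (fun i => l x (lift ord0 i)))) mA' => //.
- by move=> x; exact: (@probability_setT _ _ _ (l x ord0)).
- by move=> x; exact: (prod_measure_setT (fun i => l x (lift ord0 i))).
- by move=> B mB; exact: ml.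
- by move=> B mB; apply: IHn => // i C mC; exact: ml.
Qed.

End product_kernel.

Section dominated_image.
Context (R : realType).
Local Open Scope ereal_scope.

(** Phrased through preimages, so that the bound passes with the same constant to any measurable map
    composed after [f], with [nu] pushed forward. *)
Definition dominated_image d1 d2 (X : measurableType d1) (Y : measurableType d2)
    (f : X -> Y) (a : R) (mu : set X -> \bar R) (nu : set Y -> \bar R) :=
  forall A, measurable A -> a%:E * nu A <= mu (f @^-1` A).

Lemma dominated_imageX d1 d2 d3 d4 (X1 : measurableType d1)
    (X2 : measurableType d2) (Y1 : measurableType d3) (Y2 : measurableType d4)
    (f : X1 -> Y1) (g : X2 -> Y2) (a b : R)
    (mu1 : {measure set X1 -> \bar R})
    (mu2 : {sigma_finite_measure set X2 -> \bar R})
    (nu1 : {measure set Y1 -> \bar R})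
    (nu2 : {sigma_finite_measure set Y2 -> \bar R}) :
  (0 <= a)%R -> (0 <= b)%R -> measurable_fun setT f -> measurable_fun setT g ->
  dominated_image f a mu1 nu1 -> dominated_image g b mu2 nu2 ->
  dominated_image (fun z => (f z.1, g z.2)) (a * b) (mu1 \x mu2) (nu1 \x nu2).
Proof.
move=> a0 b0 mf mg fmu gmu B mB; pose h y := nu2 (xsection B y).
have mh : measurable_fun setT h by exact: measurable_fun_xsection.
have h0 y : 0 <= h y by exact: measure_ge0.
pose fmu1 := measure_function_pushforward__canonical__measure_function_Measure
  mu1 mf.
have le1 : a%:E * \int[nu1]_y h y <= \int[fmu1]_y h y.
  exact: ge0_integral_minorized.
have le2 : \int[mu1]_x (b%:E * h (f x)) <=
    \int[mu1]_x mu2 (xsection ((fun z => (f z.1, g z.2)) @^-1` B) x).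
  apply: ge0_le_integral => //.
  - by move=> x _; rewrite mule_ge0// lee_fin.
  - by apply: measurable_funeM; exact: measurableT_comp.
  - apply: measurable_fun_xsection; rewrite -[X in measurable X]setTI.
    have mfg : measurable_fun setT (fun z : X1 * X2 => (f z.1, g z.2)).
      by apply/measurable_fun_pair => /=; exact: measurableT_comp.
    exact: mfg.
  - move=> x _; rewrite (_ : xsection _ x = g @^-1` (xsection B (f x))).
      by apply: gmu; exact: measurable_xsection.
    by apply/seteqP; split => y; rewrite /xsection /= !inE.
apply: le_trans le2; rewrite ge0_integralZl//; last exact: measurableT_comp.
rewrite mulrC EFinM -muleA lee_wpmul2l ?lee_fin//.
apply: le_trans le1 _.
by rewrite ge0_integral_pushforward.
Qed.

(** The map depends on the index because each ensemble member is shifted by its own forecast. *)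
Definition tuple_map2 (X Y : Type) n (f : 'I_n -> X -> Y) (t : n.-tuple X) :
  n.-tuple Y := [tuple f i (tnth t i) | i < n].

Lemma measurable_tuple_map2 d1 d2 (X : measurableType d1) (Y : measurableType d2)
    n (f : 'I_n -> X -> Y) : (forall i, measurable_fun setT (f i)) ->
  measurable_fun setT (tuple_map2 f).
Proof.
move=> mf; apply/measurable_fun_tnthP => i.
rewrite (_ : _ \o _ = f i \o (@tnth n X ^~ i)).
  by apply: measurableT_comp => //; exact: measurable_tnth.
by apply/funext => t /=; rewrite tnth_mktuple.
Qed.

Lemma dominated_image_prod d1 d2 (X : measurableType d1) (Y : measurableType d2)
    n (f : 'I_n -> X -> Y) (a : R)
    (mu : 'I_n -> {sigma_finite_measure set X -> \bar R})
    (nu : 'I_n -> {sigma_finite_measure set Y -> \bar R}) :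
  (0 <= a)%R -> (forall i, measurable_fun setT (f i)) ->
  (forall i, dominated_image (f i) a (mu i) (nu i)) ->
  dominated_image (tuple_map2 f) (a ^+ n) (prod_measure mu) (prod_measure nu).
Proof.
move=> a0; elim: n f mu nu => [|n IHn] f mu nu mf fmu A mA.
  rewrite expr0 mul1e /= !diracE.
  rewrite (_ : ([tuple] \in tuple_map2 f @^-1` A) = ([tuple] \in A)) //.
  apply/idP/idP; rewrite !inE /= /tuple_map2.
    by rewrite (tuple0 [tuple f i (tnth _ i) | i < 0]).
  by rewrite (tuple0 [tuple f i (tnth _ i) | i < 0]).
have mA' : measurable (@cons_pair _ Y n @^-1` A).
  by rewrite -[X in measurable X]setTI; exact: measurable_cons_pair.
have := dominated_imageX a0 (exprn_ge0 n a0) (mf ord0)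
  (measurable_tuple_map2 (fun i => mf (lift ord0 i))) (fmu ord0)
  (IHn _ _ _ (fun i => mf (lift ord0 i)) (fun i => fmu (lift ord0 i))) mA'.
rewrite -exprS /= /cons_measure /pushforward => /le_trans; apply.
rewrite le_eqVlt; apply/orP; left; apply/eqP; congr (_ _).
apply/seteqP; split => -[x t] /=; rewrite (_ : cons_pair _ =
  tuple_map2 f (cons_pair (x, t)))//; apply: eq_from_tnth => i;
  by rewrite tnth_mktuple; case: (unliftP ord0 i) => [j ->|->];
    rewrite ?tnthS ?tnth0 ?tnth_mktuple//= /cons_pair /= ?tnth0 ?tnthS.
Qed.

End dominated_image.

(** * Minorization by the nondegenerate noise *)

Section unit_box.
Context (R : realType).

(** Lebesgue measure is determined by half-open intervals, whose length a translation preserves. The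
    form [dominated_image] with constant [1] lets [dominated_image_prod] carry the bound to several
    dimensions. *)
Lemma lebesgue_measure_translation (p : R) :
  dominated_image (fun t : R => p + t) 1
    (@lebesgue_measure R) (@lebesgue_measure R).
Proof.
move=> A mA; rewrite mul1e.
have mp : measurable_fun [set: R] (fun t : R => p + t).
  by apply: measurable_funD; [exact: measurable_cst|exact: measurable_id].
have mp' : measurable_fun [set: measurableTypeR R]
    (fun t : measurableTypeR R => (p + t : measurableTypeR R)) := mp.
pose nu := measure_function_pushforward__canonical__measure_function_Measure
  (@lebesgue_measure R) mp'.
have H X : ocitv X -> lebesgue_measure X = nu X.
  move=> [[a b] _ <-]; rewrite /nu /= /pushforward.
  rewrite (_ : _ @^-1` _ = `]a - p, b - p]%classic).
    rewrite !lebesgue_measure_itv/= !lte_fin ltrD2r.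
    by case: ifP => // _; rewrite -!EFinB; congr EFin; ring.
  by apply/seteqP; split => x /=; rewrite !in_itv/= => /andP[? ?];
    apply/andP; split; lra.
have := @lebesgue_measure_unique R nu H A mA => ->.
exact: lexx.
Qed.

Definition col_of_tuple n (t : n.-tuple R) : 'cV[R]_n := \col_i tnth t i.

Lemma measurable_col_of_tuple n : measurable_fun setT (@col_of_tuple n).
Proof.
apply: measurable_fun_mx => i j; rewrite (_ : (fun t => _) = @tnth n R ^~ i).
  exact: measurable_tnth.
by apply/funext => t; rewrite mxE.
Qed.

Lemma lebesgue_cV_translation n (p : 'cV[R]_n) (A : set 'cV[R]_n) :
  measurable A ->
  (lebesgue_cV A <= lebesgue_cV [set z : 'cV[R]_n | A (p + z)%R])%E.
Proof.
move=> mA; rewrite /lebesgue_cV.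
have mA' : measurable (@col_of_tuple n @^-1` A).
  by rewrite -[X in measurable X]setTI; exact: measurable_col_of_tuple.
have mp (i : 'I_n) : measurable_fun setT (fun t : R => p i 0 + t).
  by apply: measurable_funD; [exact: measurable_cst|exact: measurable_id].
have h := @dominated_image_prod R _ _ (measurableTypeR R) (measurableTypeR R) n (fun i (t : R) => p i 0 + t) 1
  (fun=> @lebesgue_measure R) (fun=> @lebesgue_measure R) ler01 mp
  (fun i => @lebesgue_measure_translation (p i 0)) _ mA'.
rewrite expr1n mul1e in h.
apply: le_trans h _; rewrite le_eqVlt; apply/orP; left; apply/eqP.
congr (prod_measure _ _); apply/seteqP; split => t /=;
  rewrite (_ : col_of_tuple _ = p + \col_i tnth t i)//;
  by apply/matrixP => i j; rewrite !mxE tnth_mktuple (ord1 j).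
Qed.

Definition unit_box n : set 'cV[R]_n := [set x | forall i, x i 0 \in `[0, 1]].

Lemma measurable_unit_box n : measurable (@unit_box n).
Proof.
rewrite (_ : @unit_box n = \bigcap_(i in [set: 'I_n])
    ((@mx_entry R n 1 i 0) @^-1` `[0, 1]%classic)); last first.
  by apply/seteqP; split => x /= h i *; exact: h.
apply: fin_bigcap_measurable => // i _; rewrite -[X in measurable X]setTI.
by apply: measurable_mx_entry => //; exact: measurable_itv.
Qed.

Lemma unit_box_law n : exists nu : probability 'cV[R]_n R,
  forall A, measurable A -> nu A = lebesgue_cV (A `&` @unit_box n).
Proof.
pose leb := measure_function_pushforward__canonical__measure_function_Measure
  (prod_measure (fun _ : 'I_n => @lebesgue_measure R)) (@measurable_col_of_tuple n).
have box1 : mrestr leb (@measurable_unit_box n) setT = 1%E.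
  rewrite /mrestr setTI -[leb _]/(lebesgue_cV _).
  rewrite (_ : @unit_box n = [set x | forall i, x i 0 \in
    `[(0 : 'cV[R]_n) i 0, (const_mx 1 : 'cV[R]_n) i 0]]).
    rewrite lebesgue_cV_box => [|i]; last by rewrite !mxE.
    by rewrite big1// => i _; rewrite !mxE subr0.
  by apply/seteqP; split => x /= h i; have := h i; rewrite !mxE.
have [nu nuE] := probability_of_measure box1.
by exists nu => A mA; rewrite nuE.
Qed.

End unit_box.

Section enorm.
Context (R : realType) (n : nat).
Implicit Type u : 'cV[R]_n.

Lemma enorm_sqr u : enorm u ^+ 2 = \sum_i u i 0 ^+ 2.
Proof. by rewrite sqr_sqrtr// sumr_ge0// => i _; exact: sqr_ge0. Qed.

Lemma enorm_entry u i : `|u i 0| <= enorm u.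
Proof.
rewrite -ler_sqr ?nnegrE ?sqrtr_ge0// enorm_sqr real_normK ?num_real//.
by rewrite (bigD1 i)//= lerDl sumr_ge0// => j _; exact: sqr_ge0.
Qed.

Lemma enorm_le u (B : R) : 0 <= B -> (forall i, `|u i 0| <= B) ->
  enorm u <= Num.sqrt (n%:R * B ^+ 2).
Proof.
move=> B0 uB; apply: ler_wsqrtr.
rewrite [leRHS](_ : _ = \sum_(i < n) B ^+ 2); last first.
  by rewrite sumr_const card_ord mulr_natl.
apply: ler_sum => i _; rewrite -[leLHS]real_normK ?num_real//.
by rewrite ler_sqr ?nnegrE.
Qed.

Lemma continuous_enorm (T : topologicalType) (f : T -> 'cV[R]_n) :
  mx_continuous f -> continuous (fun x => enorm (f x)).
Proof.
move=> cf x.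
apply: (@continuous_comp _ _ _ (fun x => \sum_i f x i 0 ^+ 2) (@Num.sqrt R)).
  apply: continuous_sum => i y.
  by apply: (@cvgM _ _ (nbhs y) _ (fun x => f x i 0) (fun x => f x i 0));
    exact: cf.
exact: sqrt_continuous.
Qed.

Lemma measurable_enorm_le (M : R) : measurable [set u : 'cV[R]_n | enorm u <= M].
Proof.
apply: measurable_closed_mx.
apply: (@closed_le_fun R _ (fun u : 'cV[R]_n => enorm u) (fun=> M)).
  2: exact: cst_continuous.
by apply: continuous_enorm; apply: continuous_mx => x; exact: cvg_id.
Qed.

End enorm.

Lemma compact_bounded_above (T : topologicalType) (R : realType) (A : set T)
    (f : T -> R) : compact A -> continuous f ->
  exists B : R, forall x, A x -> f x <= B.
Proof.
move=> cA cf; have [A0|nA] := pselect (A !=set0).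
  have [|c _ fc] := @compact_EVT_max T R f A A0 cA.
    exact: continuous_subspaceT.
  by exists (f c) => x Ax; apply: fc; rewrite inE.
by exists 0 => x Ax; case: nA; exists x.
Qed.

Section nondegenerate.
Context (R : realType) (d : nat) (Q : 'cV[R]_d -> probability 'cV[R]_d R).
Hypothesis ndQ : nondegenerate_noise Q.

(** The noise ball is chosen so large that, for every centre [p] with entries bounded by [B], it
    contains all [z] with [p + z] in the unit box; hence one constant [a] serves all [u] and [p]. *)
Lemma nondegenerate_box (nu : probability 'cV[R]_d R) :
  (forall A, measurable A -> nu A = lebesgue_cV (A `&` @unit_box R d)) ->
  forall M B : R, exists2 a : R, 0 < a &
    forall u p : 'cV[R]_d, enorm u <= M -> (forall i, `|p i 0| <= B) ->
      dominated_image (fun z : 'cV[R]_d => p + z) a (Q u) nu.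
Proof.
(* If [p + z] is in the unit box, the entries of [z] are at most [B1] in absolute value. The maxima
   with [0] keep the radii positive whatever the signs of [M] and [B]. *)
move=> nuE M B; pose B1 := Num.max 0 B + 1.
have B10 : 0 <= B1 by rewrite addr_ge0// le_max lexx.
pose M2 := Num.sqrt (d%:R * B1 ^+ 2) + 1.
have M20 : 0 < M2 by rewrite ltr_wpDl// sqrtr_ge0.
have M10 : 0 < Num.max 0 M + 1 by rewrite ltr_wpDl// le_max lexx.
have [a a0 Qa] := ndQ M10 M20; exists a => // u p uM pB A mA.
have mp : measurable_fun setT (fun z : 'cV[R]_d => p + z).
  by apply: measurable_fun_addmx; [exact: measurable_cst|exact: measurable_id].
have mpA (C : set 'cV[R]_d) : measurable C -> measurable [set z | C (p + z)].
  by move=> mC; rewrite -[X in measurable X]setTI; exact: mp.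
have mAb : measurable (A `&` @unit_box R d).
  by apply: measurableI => //; exact: measurable_unit_box.
have uM' : enorm u <= Num.max 0 M + 1.
  by apply: le_trans uM _; rewrite -[leLHS]addr0 lerD// le_max lexx orbT.
apply: le_trans (Qa u uM' _ (mpA A mA)).
rewrite lee_wpmul2l ?lee_fin ?(ltW a0)// nuE//.
apply: le_trans (lebesgue_cV_translation p mAb) _.
pose leb := measure_function_pushforward__canonical__measure_function_Measure
  (prod_measure (fun _ : 'I_d => @lebesgue_measure R)) (@measurable_col_of_tuple R d).
apply: (@le_measure _ _ _ leb); rewrite ?inE.
- exact: mpA.
- by apply: measurableI; [exact: mpA|exact: measurable_enorm_le].
move=> z [Az bz]; split => //=.
have : enorm z <= Num.sqrt (d%:R * B1 ^+ 2).
  apply: enorm_le => // i; have := bz i; have := pB i; rewrite mxE in_itv/=.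
  have : B <= Num.max 0 B by rewrite le_max lexx orbT.
  by rewrite !ler_norml /B1 => ? /andP[? ?] /andP[? ?]; apply/andP; split; lra.
by rewrite /M2; lra.
Qed.

Lemma kinetic_bounded (Psi : 'cV[R]_d -> 'cV[R]_d) Rh :
  (forall u, has_mean_cov (Q u) 0 (Rh u)) -> kinetic_energy_principle Psi Rh ->
  forall M : R, exists B : R, forall u, enorm u <= M ->
    forall i, `|Psi u i 0| <= B.
Proof.
move=> Qcov [beta [Kh [/andP[b0 b1] Kh0 kin]]] M.
exists (Num.sqrt (M ^+ 2 + Kh)) => u uM i.
apply: le_trans (enorm_entry _ i) _; rewrite -[leLHS]ger0_norm ?sqrtr_ge0//.
rewrite -sqrtr_sqr; apply: ler_wsqrtr.
have trR : 0 <= \tr (Rh u).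
  apply: sumr_ge0 => j _; have [_ _ covE] := Qcov u.
  by rewrite -lee_fin -covE; exact: variance_ge0.
have uM2 : enorm u ^+ 2 <= M ^+ 2.
  by rewrite ler_sqr ?nnegrE ?sqrtr_ge0// (le_trans _ uM)// sqrtr_ge0.
have bu : 0 <= beta * enorm u ^+ 2 by rewrite mulr_ge0 ?sqr_ge0// ltW.
by have := kin u; lra.
Qed.

End nondegenerate.

(** * The filter chain *)

Section filter_chain.
Context (R : realType) (d q K : nat) (H : 'M[R]_(q, d)).
Local Notation state := ('cV[R]_d * 'M[R]_(d, K))%type.
Local Notation noise := ('cV[R]_d * 'cV[R]_q * K.-tuple 'cV[R]_d)%type.
Context (Gamma : 'cV[R]_d * 'M[R]_(d, K) * 'cV[R]_q -> state)
  (Psi : 'cV[R]_d -> 'cV[R]_d)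
  (Q : 'cV[R]_d -> probability 'cV[R]_d R)
  (N : probability 'cV[R]_q R).
Hypothesis mGamma : measurable_fun setT Gamma.
Hypothesis mPsi : measurable_fun setT Psi.
Hypothesis mQ : forall A, measurable A -> measurable_fun setT (fun u => Q u A).

(** Splits a step so that the current state enters only through a translation of the noise;
    [assimilate] is the same map for all states, so a bound uniform in [x] before it stays uniform
    after it. *)
Definition shift_noise (x : state) (w : noise) : noise :=
  ((Psi x.1 + w.1.1, w.1.2),
   tuple_map2 (fun k z => Psi (col k x.2) + z) w.2).

Definition assimilate (w : noise) : state :=
  Gamma (w.1.1, \matrix_(i, k) tnth w.2 k i 0, H *m w.1.1 + w.1.2).

Lemma filter_stepE x w :
  filter_step H Gamma Psi x w = assimilate (shift_noise x w).
Proof.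
case: w => [[z xi] zs]; rewrite /filter_step /assimilate /=.
congr (Gamma (_, _, _)); apply/matrixP => i k.
by rewrite !mxE tnth_mktuple !mxE.
Qed.

Lemma measurable_assimilate : measurable_fun setT assimilate.
Proof.
apply: (measurableT_comp mGamma).
have mu : measurable_fun setT (fun w : noise => w.1.1).
  exact: measurableT_comp measurable_fst measurable_fst.
have mxi : measurable_fun setT (fun w : noise => w.1.2).
  exact: measurableT_comp measurable_snd measurable_fst.
apply/measurable_fun_pair => /=; first apply/measurable_fun_pair => //=.
  apply: measurable_fun_mx => i k; under eq_fun do rewrite mxE.
  apply: measurable_fun_mx_entry.
  exact: (measurableT_comp (measurable_tnth k) measurable_snd).
by apply: measurable_fun_addmx => //; apply: measurable_fun_mulmx.
Qed.

Lemma measurable_col (k : 'I_K) :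
  measurable_fun setT (fun x : state => col k x.2).
Proof.
apply: measurable_fun_mx => i j; under eq_fun do rewrite mxE.
by apply: measurable_fun_mx_entry; exact: measurable_snd.
Qed.

Lemma measurable_filter_step :
  measurable_fun setT (fun z : state * noise => filter_step H Gamma Psi z.1 z.2).
Proof.
under eq_fun do rewrite filter_stepE.
apply: (measurableT_comp measurable_assimilate).
have mx : measurable_fun setT (fun z : state * noise => Psi z.1.1).
  apply: (measurableT_comp mPsi).
  exact: measurableT_comp measurable_fst measurable_fst.
have mw1 : measurable_fun setT (fun z : state * noise => z.2.1).
  exact: measurableT_comp measurable_fst measurable_snd.
apply/measurable_fun_pair => /=.
  apply/measurable_fun_pair => /=.
    apply: measurable_fun_addmx => //.
    exact: (measurableT_comp measurable_fst mw1).
  exact: (measurableT_comp measurable_snd mw1).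
apply/measurable_fun_tnthP => k.
rewrite (_ : _ \o _ = fun z : state * noise =>
    Psi (col k z.1.2) + tnth z.2.2 k); last first.
  by apply/funext => z /=; rewrite tnth_mktuple.
apply: measurable_fun_addmx.
  apply: (measurableT_comp mPsi).
  exact: (measurableT_comp (measurable_col k) measurable_fst).
apply: (measurableT_comp (measurable_tnth k)).
exact: measurableT_comp measurable_snd measurable_snd.
Qed.

Local Open Scope ereal_scope.

Lemma noise_law_setT (x : state) : noise_law Q N x setT = 1.
Proof.
apply: product_measure_setT; last first.
  exact: (prod_measure_setT (fun k => Q (col k x.2))).
apply: product_measure_setT; first exact: (@probability_setT _ _ _ (Q x.1)).
exact: (@probability_setT _ _ _ N).
Qed.

Lemma measurable_noise_law B : measurable B ->
  measurable_fun setT (fun x : state => noise_law Q N x B).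
Proof.
apply: (measurable_product_kernel
  (l1 := fun x : state => (Q x.1 \x N : {measure set _ -> \bar R}))
  (l2 := fun x : state => prod_measure (fun k => Q (col k x.2)))).
- move=> x; apply: product_measure_setT.
    exact: (@probability_setT _ _ _ (Q x.1)).
  exact: (@probability_setT _ _ _ N).
- by move=> x; exact: (prod_measure_setT (fun k => Q (col k x.2))).
- apply: (measurable_product_kernel (l1 := fun x : state => Q x.1)
    (l2 := fun=> N)).
  + by move=> x; exact: (@probability_setT _ _ _ (Q x.1)).
  + by move=> x; exact: (@probability_setT _ _ _ N).
  + by move=> A mA; exact: (measurableT_comp (mQ mA) measurable_fst).
  + by move=> A mA; exact: measurable_cst.
- apply: measurable_prod_kernel => k A mA.
  exact: (measurableT_comp (mQ mA) (measurable_col k)).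
Qed.

Lemma measurable_filter_step_noise x :
  measurable_fun setT (filter_step H Gamma Psi x).
Proof.
have mp : measurable_fun setT (fun w : noise => (x, w)).
  apply/measurable_fun_pair => /=; first exact: measurable_cst.
  exact: measurable_id.
exact: (measurableT_comp measurable_filter_step mp).
Qed.

Lemma measurable_transition A : measurable A ->
  measurable_fun setT (fun x => transition H Gamma Psi Q N x A).
Proof.
move=> mA; pose B := [set z : state * noise | A (filter_step H Gamma Psi z.1 z.2)].
have mB : measurable B.
  by rewrite -[X in measurable X]setTI; exact: measurable_filter_step.
rewrite (_ : (fun x => _) = (fun x => noise_law Q N x (xsection B x))).
  exact: (measurable_fun_section measurable_noise_law noise_law_setT mB).
apply/funext => x; rewrite /transition; congr (noise_law Q N x _).
by apply/seteqP; split => w; rewrite /xsection /= !inE.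
Qed.

Lemma transition_probability : exists P : state -> probability state R,
  forall x A, P x A = transition H Gamma Psi Q N x A.
Proof.
have H1 x : exists p : probability state R,
    forall A, p A = transition H Gamma Psi Q N x A.
  pose m := measure_function_pushforward__canonical__measure_function_Measure
    (noise_law Q N x) (measurable_filter_step_noise x).
  have m1 : m setT = 1 by exact: noise_law_setT.
  by have [p pE] := probability_of_measure m1; exists p => A; rewrite pE.
by have [P PE] := boolp.choice H1; exists P.
Qed.

Section with_kernel.
Context (P : state -> probability state R).
Hypothesis PE : forall x A, P x A = transition H Gamma Psi Q N x A.

Lemma next_expectationE (f : state -> \bar R) x : (forall y, 0 <= f y) ->
  measurable_fun setT f ->
  next_expectation H Gamma Psi Q N f x = \int[P x]_y f y.
Proof.
move=> f0 mf; pose m :=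
  measure_function_pushforward__canonical__measure_function_Measure
    (noise_law Q N x) (measurable_filter_step_noise x).
rewrite (@eq_measure_integral _ _ _ setT m (P x)); last first.
  by move=> A mA _; rewrite PE.
by rewrite ge0_integral_pushforward//; exact: measurable_filter_step_noise.
Qed.

Lemma n_stepE n x A : measurable A ->
  n_step H Gamma Psi Q N n x A = (markov_iter P n \1_A x)%:E.
Proof.
move=> mA; have mP B : measurable B -> measurable_fun setT (fun x => P x B).
  by move=> mB; under eq_fun do rewrite PE; exact: measurable_transition.
elim: n x => [x|n IHn x]; first by rewrite /= diracE indicE.
have bA := bmeas_indic R mA; have bn := bmeas_markov_iter mP n bA.
have I0 y : (0 <= markov_iter P n \1_A y)%R.
  have mI := mean_functional_markov_iter mP n y.
  rewrite -(mean_functional_cst mI 0); case: mI => _ _ + _; apply => //.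
  exact: bmeas_cst.
rewrite /= (_ : n_step _ _ _ _ _ n ^~ A = fun y => (markov_iter P n \1_A y)%:E).
  rewrite next_expectationE.
  - rewrite -[RHS]fineK//; rewrite /markov_iter /= /markov_op /Rintegral fineK//.
    exact: (integrable_fin_num measurableT (bmeas_integrable (P x) bn)).
  - by move=> y; rewrite lee_fin.
  - by apply/measurable_EFinP; case: bn.
by apply/funext => y; exact: IHn.
Qed.

End with_kernel.

(** One factor [a] for the signal, [1] for the observation noise, whose law does not depend on the
    state, and [a] for each of the [K] members. *)
Lemma shift_noise_dominated (nu : probability 'cV[R]_d R) a x : (0 <= a)%R ->
  dominated_image (fun z => Psi x.1 + z)%R a (Q x.1) nu ->
  (forall k, dominated_image (fun z => Psi (col k x.2) + z)%R a (Q (col k x.2)) nu) ->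
  dominated_image (shift_noise x) (a * 1 * a ^+ K) (noise_law Q N x)
    ((nu \x N) \x prod_measure (fun _ : 'I_K => nu)).
Proof.
move=> a0 Qx Qk.
have madd (p : 'cV[R]_d) : measurable_fun setT (fun z : 'cV[R]_d => p + z)%R.
  by apply: measurable_fun_addmx; [exact: measurable_cst|exact: measurable_id].
have N1 : dominated_image (@idfun 'cV[R]_q) 1 N N by move=> A mA; rewrite mul1e.
apply: (dominated_imageX (f := fun w : 'cV[R]_d * 'cV[R]_q =>
    (Psi x.1 + w.1, w.2)%R)
  (g := tuple_map2 (fun k z => Psi (col k x.2) + z)%R)).
- by rewrite mulr1.
- exact: exprn_ge0.
- apply/measurable_fun_pair => /=; last exact: measurable_snd.
  exact: measurableT_comp (madd _) measurable_fst.
- by apply: measurable_tuple_map2 => k; exact: madd.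
- exact: (dominated_imageX a0 ler01 (madd _) (@measurable_id _ _ setT) Qx N1).
- exact: (dominated_image_prod a0 (fun k => madd (Psi (col k x.2))) Qk).
Qed.

End filter_chain.

Lemma integral_deviation_bound d (T : measurableType d) (R : realType)
    (mu : probability T R) (g E : T -> R) (p C : R) :
  bmeas g -> measurable_fun setT E -> (forall x, 0 <= E x) -> 0 < C ->
  (forall x, `|g x - p| <= C * (1 + E x)) ->
  (`|\int[mu]_x (g x)%:E - p%:E| <= C%:E * (1 + \int[mu]_x (E x)%:E))%E.
Proof.
move=> bg mE E0 C0 gp.
have I0 : (0 <= \int[mu]_x (E x)%:E)%E.
  by apply: integral_ge0 => x _; rewrite lee_fin.
(* If [E] has infinite mean, the right-hand side is infinite. *)
have [Ifin|] := boolP (\int[mu]_x (E x)%:E < +oo)%E; last first.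
  by rewrite -leNgt leye_eq => /eqP ->; rewrite addey// gt0_muley ?lte_fin ?leey.
have iE : mu.-integrable setT (EFin \o E).
  apply/integrableP; split; first exact/measurable_EFinP.
  by under eq_integral do rewrite /= ger0_norm//.
have mI := mean_functional_Rintegral mu.
have -> : (\int[mu]_x (g x)%:E = (\int[mu]_x g x)%:E)%E.
  rewrite /Rintegral fineK//.
  exact: (integrable_fin_num measurableT (bmeas_integrable mu bg)).
have -> : (\int[mu]_x (E x)%:E = (\int[mu]_x E x)%:E)%E.
  by rewrite /Rintegral fineK//; exact: (integrable_fin_num measurableT iE).
rewrite -EFinB -EFinD -EFinM lee_fin.
have bgp : bmeas (fun x => g x - p) by exact: bmeasD bg (bmeas_cst _ (- p)).
have <- : \int[mu]_x (g x - p) = \int[mu]_x g x - p.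
  by rewrite (mean_functionalB mI)// ?(mean_functional_cst mI)//; exact: bmeas_cst.
have igp := bmeas_integrable mu bgp.
apply: le_trans (le_normr_Rintegral measurableT igp) _.
have i1E := integrable_EFinD (bmeas_integrable mu (bmeas_cst T (1 : R))) iE.
apply: (@le_trans _ _ (\int[mu]_x (C * (1 + E x)))).
  apply: (le_Rintegral measurableT (integrable_norm igp)) => [|x _].
    exact: integrable_EFinZ.
  exact: gp.
rewrite (RintegralZl C measurableT i1E).
rewrite (RintegralD measurableT (bmeas_integrable mu (bmeas_cst T (1 : R))) iE).
by rewrite (mean_functional_cst mI).
Qed.

Theorem theorem5p8 (R : realType) (d q K : nat) (H : 'M[R]_(q, d)) :
  (1 <= q)%N -> (q <= d)%N -> (2 <= K)%N -> \rank H = q ->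
  exists Gamma : 'cV[R]_d * 'M[R]_(d, K) * 'cV[R]_q -> 'cV[R]_d * 'M[R]_(d, K),
    eakf_update_map H Gamma /\
    forall (Psi : 'cV[R]_d -> 'cV[R]_d)
           (Q : 'cV[R]_d -> probability 'cV[R]_d R)
           (Rh : 'cV[R]_d -> 'M[R]_d)
           (N : probability 'cV[R]_q R),
      measurable_fun setT Psi ->
      (forall A, measurable A -> measurable_fun setT (fun u => Q u A)) ->
      (forall u, has_mean_cov (Q u) 0 (Rh u)) ->
      has_mean_cov N 0 1%:M ->
      kinetic_energy_principle Psi Rh ->
      nondegenerate_noise Q ->
      forall E : 'cV[R]_d * 'M[R]_(d, K) -> R,
        strong_lyapunov H Gamma Psi Q N E ->
        geometrically_ergodic H Gamma Psi Q N E.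
Proof.
move=> _ _ K2 _; have K1 : (1 <= K)%N by exact: ltnW.
have [Gamma HG] := @eakf_update_map_exists R d q K H K1.
exists Gamma; split => //.
move=> Psi Q Rh N mPsi mQ covQ _ kin nd E [E0 Ecpt [beta [c [b01 c0 lyap]]]].
have mGamma : measurable_fun setT Gamma := HG.1.
(* Compact sublevel sets are closed, hence measurable. *)
have mE : measurable_fun setT E.
  apply: measurable_fun_le_sets => t; apply: measurable_closed_mxX.
  by apply: compact_closed (Ecpt t); exact: norm_hausdorff.
have [P PE] := @transition_probability R d q K H Gamma Psi Q N mGamma mPsi.
have mP A : measurable A -> measurable_fun setT (fun x => P x A).
  by move=> mA; under eq_fun do rewrite PE; exact: measurable_transition.
have lyapP x : (\int[P x]_y (E y)%:E <= ((1 - beta) * E x + c)%:E)%E.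
  rewrite -(@next_expectationE R d q K H Gamma Psi Q N mGamma mPsi P PE
    (EFin \o E)); first exact: lyap.
  - by move=> y; rewrite /= lee_fin.
  - exact/measurable_EFinP.
have minor M : exists (a : R) (nu : probability ('cV[R]_d * 'M[R]_(d, K))%type R),
    0 < a /\ forall x, E x <= M ->
    forall A, measurable A -> (a%:E * nu A <= P x A)%E.
  (* One continuous function that dominates all the norms: its maximum over a compact sublevel set
     bounds the signal and all members together. *)
  pose g (x : 'cV[R]_d * 'M[R]_(d, K)) :=
    enorm x.1 + \sum_(k < K) enorm (col k x.2).
  have cg : continuous g.
    have c1 : continuous (fun x : 'cV[R]_d * 'M[R]_(d, K) => enorm x.1).
      by apply: continuous_enorm; apply: continuous_mx => x; exact: cvg_fst.
    have c2 : mx_continuous (fun x : 'cV[R]_d * 'M[R]_(d, K) => x.2).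
      by apply: continuous_mx => x; exact: cvg_snd.
    have c3 : continuous (fun x : 'cV[R]_d * 'M[R]_(d, K) =>
        \sum_(k < K) enorm (col k x.2)).
      apply: continuous_sum => k; apply: continuous_enorm => i j.
      under eq_fun do rewrite mxE.
      exact: c2.
    by move=> x; apply: cvgD; [exact: c1|exact: c3].
  have [B gB] := compact_bounded_above (Ecpt M) cg.
  have [B' PsiB] := kinetic_bounded covQ kin B.
  have [nu nuE] := unit_box_law R d.
  have [a a0 Qa] := nondegenerate_box nd nuE B B'.
  have mass : ((nu \x N) \x prod_measure (fun _ : 'I_K => nu))%E setT = 1%E.
    apply: product_measure_setT; last exact: (prod_measure_setT (fun=> nu)).
    apply: product_measure_setT; first exact: (@probability_setT _ _ _ nu).
    exact: (@probability_setT _ _ _ N).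
  have mA' := @measurable_assimilate R d q K H Gamma mGamma.
  (* The minorizing measure is the image under [assimilate] of the reference law, common to all
     states of the sublevel set. *)
  pose m := measure_function_pushforward__canonical__measure_function_Measure
    ((nu \x N) \x prod_measure (fun _ : 'I_K => nu))%E mA'.
  have [pi piE] := probability_of_measure (mass : m setT = 1%E).
  exists (a * 1 * a ^+ K), pi; split => [|x Ex A mA].
    by rewrite mulr1 mulr_gt0// exprn_gt0.
  have u0 k : 0 <= enorm (col k x.2) by exact: sqrtr_ge0.
  have S0 : 0 <= \sum_(k < K) enorm (col k x.2) by exact: sumr_ge0.
  have x1B : enorm x.1 <= B by have := gB x Ex; rewrite /g; lra.
  have x2B k : enorm (col k x.2) <= B.
    apply: le_trans (gB x Ex); rewrite /g (bigD1 k)//= addrCA lerDl.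
    by rewrite addr_ge0 ?sqrtr_ge0// sumr_ge0.
  rewrite PE piE /transition (_ : filter_step _ _ _ _ @^-1` A =
    shift_noise Psi x @^-1` (assimilate H Gamma @^-1` A)); last first.
    by apply/seteqP; split => w /=; rewrite filter_stepE.
  apply: shift_noise_dominated; first exact: ltW.
  - by apply: Qa => //; exact: PsiB.
  - by move=> k; apply: Qa => //; exact: PsiB.
  - by rewrite -[X in measurable X]setTI; exact: (measurable_assimilate H mGamma).
have [pi [inv uniq [r [kappa [r01 k0 rate]]]]] :=
  harris mP mE E0 b01 c0 lyapP minor.
exists pi; split.
- move=> A mA; rewrite -inv//; apply: eq_integral => x _.
  by rewrite PE.
- move=> pi' inv'; apply: uniq => A mA; rewrite -[RHS]inv'//.
  by apply: eq_integral => x _; rewrite PE.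
- exists r, kappa; split => // mu n; apply: ge_ereal_sup => _ [A mA <-].
  rewrite /law_at; under eq_integral do rewrite (n_stepE mGamma mPsi mQ PE)//.
  rewrite -[pi A]fineK ?fin_num_measure//.
  have /andP[r0 _] := r01.
  apply: (@integral_deviation_bound _ _ _ mu (markov_iter P n \1_A) E (fine (pi A))
    (kappa * r ^+ n)) => //.
  + have bA : bmeas (\1_A : _ -> R) by exact: bmeas_indic.
    have h := @bmeas_markov_iter _ _ R P mP n _ bA; exact: h.
  + by rewrite mulr_gt0// exprn_gt0.
  + by move=> x; exact: rate.
Qed.
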